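(* Let $\Gamma^2(x_0)=(L,E)$ be the semi-infinite Cayley tree of order $2$ with root $x_0$, let $\mathcal B_x=M_2(\mathbb C)$ for every $x\in L$, and let $\beta\in\mathbb R$. For every edge $\{x,y\}\in E$, with $y$ a direct successor of $x$, put $$K_{<x,y>}=\exp\{\beta H_{<x,y>}\},\qquad H_{<x,y>}=e_{12}^{(x)}\otimes e_{21}^{(y)}+e_{21}^{(x)}\otimes e_{12}^{(y)},$$ and let $h_x=\alpha I$ for every $x\in L$ with $\alpha=\cosh^{-4}\beta$, and $w_0=(\cosh^4\beta)\,I\in\mathcal B_{x_0}$. Let $\varphi$ be the $d$-Markov chain on $\mathcal B_L$ generated by $(w_0,\{h_x\},\{K_{<x,y>}\})$, i.e. the state with $\varphi(a)=\mathrm{Tr}\big(\mathcal W_{n+1]}(a\otimes\mathbf 1_{W_{n+1}})\big)$ for all $a\in\mathcal B_{\Lambda_n}$, $n\ge0$. Then $\varphi$ is $\gamma_1$- and $\gamma_2$-invariant, i.e. $\varphi\circ\gamma_i=\varphi$ for $i=1,2$, and it satisfies the clustering property with respect to $\gamma_i$, $i=1,2$: for all $a,b\in\mathcal B_L$, $$\lim_{n\to\infty}\varphi(\gamma_i^n(a)b)=\varphi(a)\varphi(b).$$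
   Context: Tree: in $\Gamma^2(x_0)$ every vertex (including the root) has exactly $2$ direct successors. Vertices are finite words $(i_1,\dots,i_n)$ with $i_m\in\{1,2\}$, the root $x_0$ being the empty word; the direct successors of $x=(i_1,\dots,i_n)$ are $(x,i)=(i_1,\dots,i_n,i)$, $i=1,2$, and $E$ consists of the edges $\{x,(x,i)\}$. $W_n$ is the set of vertices at distance $n$ from $x_0$, $\Lambda_n=\bigcup_{m=0}^nW_m$, $E_n$ is the set of edges inside $\Lambda_n$. Algebras: $\mathcal B_\Lambda=\bigotimes_{x\in\Lambda}\mathcal B_x$ for finite $\Lambda$, identified with $\mathcal B_\Lambda\otimes I$ in larger algebras; $\mathcal B_L$ is the $C^*$-inductive limit. $e_{ij}^{(x)}$ are the standard matrix units of $\mathcal B_x=M_2(\mathbb C)$. $\mathrm{Tr}$ is the normalized trace on $\mathcal B_L$, $\mathbf 1_{W_n}=\bigotimes_{y\in W_n}\mathbf 1$. Shifts: for $i=1,2$, $\gamma_i(x)=(i,x)=(i,i_1,\dots,i_n)$ for $x=(i_1,\dots,i_n)$; $\gamma_i$ also denotes the induced unital $*$-endomorphism of $\mathcal B_L$ which maps $\mathcal B_x=M_2(\mathbb C)$ identically onto $\mathcal B_{(i,x)}=M_2(\mathbb C)$. Generated state: with $$\prod_{\{x,y\}\in E_m\setminus E_{m-1}}K_{<x,y>}:=\prod_{x\in W_{m-1}}K_{<x,(x,1)>}K_{<x,(x,2)>}$$ (factors for different $x\in W_{m-1}$ commute; $E_0=\emptyset$), put for $n\ge1$ $$K_n=w_0^{1/2}\prod_{\{x,y\}\in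 E_1}K_{<x,y>}\prod_{\{x,y\}\in E_2\setminus E_1}K_{<x,y>}\cdots\prod_{\{x,y\}\in E_n\setminus E_{n-1}}K_{<x,y>}\prod_{x\in W_n}h_x^{1/2},\qquad\mathcal W_{n]}=K_n^*K_n.$$ For $w_0=(\cosh^4\beta)\,I$, $h_x=(\cosh^{-4}\beta)\,I$ for every $x\in L$, and $K_{<x,y>}=\exp\{\beta(e_{12}^{(x)}\otimes e_{21}^{(y)}+e_{21}^{(x)}\otimes e_{12}^{(y)})\}$ for every edge $\{x,y\}\in E$ with $y$ a direct successor of $x$, the functionals $a\mapsto\mathrm{Tr}(\mathcal W_{n+1]}(a\otimes\mathbf 1_{W_{n+1}}))$ on $\mathcal B_{\Lambda_n}$ are compatible states and so determine a unique state $\varphi$ on $\mathcal B_L$. *)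

(* Defs.v *)
From HB Require Import structures.
From mathcomp Require Import all_boot all_order all_algebra.
From mathcomp Require Import finmap complex.
From mathcomp Require Import all_classical all_reals all_analysis.
Set Implicit Arguments.
Unset Strict Implicit.
Unset Printing Implicit Defensive.
Import Order.TTheory GRing.Theory Num.Theory numFieldNormedType.Exports.
Local Open Scope classical_set_scope.
Local Open Scope fset_scope.
Local Open Scope ring_scope.
Local Open Scope complex_scope.

(** * The Cayley tree of order 2 *)

(* The indices 1, 2 of the words, and of the matrix units below, are the
   elements 0, 1 of 'I_2. *)
Notation vertex := (seq 'I_2).

Definition tree_root : vertex := [::].

Definition child (x : vertex) (i : 'I_2) : vertex := rcons x i.

Definition vshift (i : 'I_2) (x : vertex) : vertex := i :: x.

Definition tree_sphere (n : nat) : seq vertex :=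
  [seq val t | t : n.-tuple 'I_2].

Definition tree_ball (n : nat) : {fset vertex} :=
  [fset x in flatten [seq tree_sphere m | m <- iota 0 n.+1]].

(** * Local algebras *)

(* The tensor product of the spaces C^2 over the sites of L has the basis
   {1,2}^L; the tensor product B_L of the algebras M_2(C) is the algebra of
   the matrices indexed by this basis. *)
Notation conf L := {ffun fset_sub_type (L : {fset vertex}) -> 'I_2}.

Notation loc R L := ('M[R[i]]_#|{: conf L}|).

(* The elementary tensor of the matrices m y, for y in L. *)
Definition tensor (R : realType) (L : {fset vertex})
    (m : vertex -> 'M[R[i]]_2) : loc R L :=
  \matrix_(p, q) \prod_(y : L)
    m (val y) ((enum_val p : conf L) y) ((enum_val q : conf L) y).

(* A 2 x 2 matrix a as an element of B_x, identified with a subalgebra of B_L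
   (only meant for x \in L; it is the identity otherwise). *)
Definition site (R : realType) (L : {fset vertex}) (x : vertex)
    (a : 'M[R[i]]_2) : loc R L :=
  tensor L (fun y => if y == x then a else 1%:M).

(* Restriction of a configuration from L' to L, for L `<=` L' (the default
   value ord0 is only used for the sites of L that are not in L'). *)
Definition conf_restrict (L L' : {fset vertex}) (p : conf L') : conf L :=
  [ffun y : L => if insub (val y) is Some z then p z else ord0].

(* The identification of a with a \otimes I, for L `<=` L'. *)
Definition loc_extend (R : realType) (L L' : {fset vertex}) (a : loc R L) :
    loc R L' :=
  \matrix_(p, q)
    (a (enum_rank (conf_restrict L (enum_val p)))
       (enum_rank (conf_restrict L (enum_val q))) *
     [forall y : L', (val y \notin L) ==>
        ((enum_val p : conf L') y == (enum_val q : conf L') y)]%:R).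

Definition adjmx (R : realType) (m n : nat) (a : 'M[R[i]]_(m, n)) :
    'M[R[i]]_(n, m) :=
  map_mx (@Num.conj R[i]) a^T.

(* Normalized trace. *)
Definition ntr (R : realType) (n : nat) (a : 'M[R[i]]_n) : R[i] :=
  \tr a / n%:R.

(* R[i]^o carries the usual topology of R[i], hence the type annotation. *)
Definition expmx (R : realType) (n : nat) (a : 'M[R[i]]_n) : 'M[R[i]]_n :=
  limn (series (fun k => ((k`!%:R : R[i])^-1 *: a ^+ k : 'M[R[i]^o]_n))).

Definition posmx (R : realType) (n : nat) (a : 'M[R[i]]_n) : Prop :=
  exists c : 'M[R[i]]_n, a = adjmx c *m c.

(* The positive square root; it is 0 on matrices that are not positive. *)
Definition sqrtmx (R : realType) (n : nat) (a : 'M[R[i]]_n) : 'M[R[i]]_n :=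
  xget 0 [set b : 'M[R[i]]_n | posmx b /\ b *m b = a].

(** * C*-algebras *)

(* Unital C*-algebras, with a real-valued norm; nonnegativity of the norm,
   its invariance under the involution and `star 1 = 1` follow. *)
HB.mixin Record isCStar (R : realType) A of GRing.Algebra R[i] A := {
  star : A -> A;
  starD : forall a b : A, star (a + b) = star a + star b;
  starZ : forall (c : R[i]) (a : A), star (c *: a) = c^* *: star a;
  starM : forall a b : A, star (a * b) = star b * star a;
  starK : forall a : A, star (star a) = a;
  cnorm : A -> R;
  cnorm_eq0 : forall a : A, cnorm a = 0 -> a = 0;
  cnormD : forall a b : A, cnorm (a + b) <= cnorm a + cnorm b;
  cnormZ : forall (c : R[i]) (a : A),
    (cnorm (c *: a))%:C = `|c| * (cnorm a)%:C;
  cnormM : forall a b : A, cnorm (a * b) <= cnorm a * cnorm b;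
  cnorm_star : forall a : A, cnorm (star a * a) = cnorm a ^+ 2;
  cnorm_complete : forall u : nat -> A,
    (forall e : R, 0 < e -> exists N : nat, forall m n : nat,
       (N <= m)%N -> (N <= n)%N -> cnorm (u m - u n) < e) ->
    exists l : A, (fun n => cnorm (u n - l)) @ \oo --> (0 : R)
}.

#[short(type="cstarAlgType")]
HB.structure Definition CStarAlgebra (R : realType) :=
  {A of isCStar R A & GRing.Algebra R[i] A}.

(* A is the C*-inductive limit of the algebras B_L along the inclusions
   a |-> a \otimes I, with canonical maps inj. *)
Record is_inductive_limit (R : realType) (A : cstarAlgType R)
    (inj : forall L : {fset vertex}, loc R L -> A) : Prop := {
  inj_linear : forall L, linear (@inj L);
  inj_mult : forall L, monoid_morphism (@inj L);
  inj_star : forall L (a : loc R L), inj L (adjmx a) = star (inj L a);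
  inj_injective : forall L, injective (@inj L);
  inj_compatible : forall (L L' : {fset vertex}) (a : loc R L),
    (L `<=` L')%fset -> inj L' (loc_extend L' a) = inj L a;
  inj_dense : forall (a : A) (e : R), 0 < e ->
    exists (L : {fset vertex}) (b : loc R L), cnorm (a - inj L b) < e
}.

(* g is the unital *-endomorphism of A induced by the shift i. *)
Record is_shift (R : realType) (A : cstarAlgType R)
    (inj : forall L : {fset vertex}, loc R L -> A) (i : 'I_2) (g : A -> A) :
    Prop := {
  shift_linear : linear g;
  shift_mult : monoid_morphism g;
  shift_star : forall a, g (star a) = star (g a);
  shift_site : forall (x : vertex) (m : 'M[R[i]]_2),
    g (inj [fset x] (site [fset x] x m)) =
    inj [fset vshift i x] (site [fset vshift i x] (vshift i x) m)
}.

Record is_state (R : realType) (A : cstarAlgType R) (phi : A -> R[i]) :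
    Prop := {
  state_linear : scalar phi;
  state_pos : forall a, 0 <= phi (star a * a);
  state_1 : phi 1 = 1
}.

(** * Markov chains on the tree *)

(* h x and K x y stand for h_x and K_<x,y>; K x y is used only when y is a
   direct successor of x. The factors of the products over a sphere commute
   when the edge operators do, so the order of the enumeration is immaterial. *)
Definition chain_op (R : realType) (w0 : 'M[R[i]]_2)
    (h : vertex -> 'M[R[i]]_2) (K : forall x y : vertex, loc R [fset x; y]) (n : nat) :
    loc R (tree_ball n) :=
  site (tree_ball n) tree_root (sqrtmx w0) *
  (\prod_(m < n) \prod_(x <- tree_sphere m)
     (loc_extend (tree_ball n) (K x (child x 0)) *
      loc_extend (tree_ball n) (K x (child x 1)))) *
  \prod_(x <- tree_sphere n) site (tree_ball n) x (sqrtmx (h x)).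

Definition chain_density (R : realType) (w0 : 'M[R[i]]_2)
    (h : vertex -> 'M[R[i]]_2) (K : forall x y : vertex, loc R [fset x; y])
    (n : nat) : loc R (tree_ball n) :=
  adjmx (chain_op w0 h K n) * chain_op w0 h K n.

Record is_markov_chain (R : realType) (A : cstarAlgType R)
    (inj : forall L : {fset vertex}, loc R L -> A)
    (w0 : 'M[R[i]]_2) (h : vertex -> 'M[R[i]]_2)
    (K : forall x y : vertex, loc R [fset x; y]) (phi : A -> R[i]) : Prop := {
  chain_state : is_state phi;
  chain_local : forall (n : nat) (a : loc R (tree_ball n)),
    phi (inj (tree_ball n) a) =
    ntr (chain_density w0 h K n.+1 * loc_extend (tree_ball n.+1) a)
}.

Definition state_invariant (R : realType) (A : cstarAlgType R)
    (phi : A -> R[i]) (g : A -> A) : Prop :=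
  forall a, phi (g a) = phi a.

Definition clustering (R : realType) (A : cstarAlgType R) (phi : A -> R[i])
    (g : A -> A) : Prop :=
  forall a b : A,
    (fun n => phi (iter n g a * b) : R[i]^o) @ \oo --> (phi a * phi b : R[i]^o).

(** * The XY interaction *)

Definition xyH (R : realType) (x y : vertex) : loc R [fset x; y] :=
  site [fset x; y] x (delta_mx 0 1) * site [fset x; y] y (delta_mx 1 0) +
  site [fset x; y] x (delta_mx 1 0) * site [fset x; y] y (delta_mx 0 1).

Definition xyK (R : realType) (beta : R) (x y : vertex) : loc R [fset x; y] :=
  expmx (beta%:C *: xyH R x y).

Definition cosh (R : realType) (t : R) : R := (expR t + expR (- t)) / 2.

(* Main.v *)
Require Import Defs.
From HB Require Import structures.
From mathcomp Require Import all_boot all_order all_algebra.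
From mathcomp Require Import finmap complex.
From mathcomp Require Import all_classical all_reals all_analysis.
From mathcomp Require Import ring lra.
Import Order.TTheory GRing.Theory Num.Theory numFieldNormedType.Exports.
Local Open Scope classical_set_scope.
Local Open Scope fset_scope.
Local Open Scope ring_scope.
Local Open Scope complex_scope.

(** Write C and S for the hyperbolic cosine and sine of beta, so that
    C^2 - S^2 = 1. The interaction H of an edge satisfies H^3 = H, hence
    K = 1 + (C - 1) H^2 + S H; in the matrix units of the lower end of the edge,
    K is a sum of four elementary tensors (expmx_cubic, xyK_edge_op).

    The value of the chain on an elementary tensor is found by removing leaves.
    The operators w_0 and h_x are scalar, so the density is, up to a scalar, the
    product of the K's conjugated in the order of the generations. By traciality
    the K of an outermost edge (x, y) conjugates the observable instead, and
    since the rest of the density lives off y, the site y can be traced out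
    (ntr_site, edge_trace): the matrices (a, b) at x and y are replaced by a
    bilinear expression edge_red a b at x and by 1 at y. The two edges below x
    give the vertex map vertex_red, and its iteration from the leaves to the root
    is tree_red. So phi of a tensor is the normalized trace of one 2 x 2 matrix
    (chain_prod_trace, phi_local_tensor). The scalar factor is 1,
    because phi 1 = 1 and vertex_red 1 1 1 = 1.

    The shift gamma_i moves the tensor to the subtree at the i-th child and puts
    1 everywhere else. The contraction B of the tensor then becomes T_i B, where
    T_i = branch_red i is the vertex map with 1 in the two other slots. A
    computation with 2 x 2 matrices gives
      T_i B = tr(B) 1 + lambda_i offdiag(B),
    with lambda_1 = S / C^2 and lambda_2 = S / C^3 (branch_redE). Thus T_i
    preserves the trace, which is the invariance. If b lives in the first l
    generations, the contraction of gamma_i^(l + j)(a) b is a linear function G,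
    depending on b only, of T_i^j B (tree_red_below). As |lambda_i| < 1,
    T_i^j B tends to tr(B) 1, and the limit is tr(B) tr(G 1) = phi(a) phi(b)
    (clusters_local_tensor).

    Passing from tensors to the whole C*-algebra needs bounds on
    phi(gamma_i^n(a) b) that are uniform in n. A positive functional is bounded:
    if z is self-adjoint and small, then 1 - z = y^2 with y self-adjoint
    (one_minus_is_square), whence phi (star x * x) <= 1 for small x, and
    polarization controls phi (star y * x). The bound is the same for all states,
    in particular for the states phi o gamma_i^n (state_bound). The span of the tensors is dense, and the limits extend
    by continuity (dense_cvg). *)

(** * Elementary tensors *)

Lemma sum_conf (R : realType) (L : {fset vertex}) (F : conf L -> R[i]) :
  \sum_(k < #|{: conf L}|) F (enum_val k) = \sum_(f : conf L) F f.
Proof.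
rewrite [RHS](reindex_onto (@enum_val _ _) enum_rank) /=; last by move=> i _; rewrite enum_rankK.
by apply: eq_bigl => k; rewrite enum_valK eqxx.
Qed.

Lemma tensorM (R : realType) (L : {fset vertex}) (m m' : vertex -> 'M[R[i]]_2) :
  tensor L m * tensor L m' = tensor L (fun y => m y * m' y).
Proof.
apply/matrixP => p q; rewrite !mxE.
under eq_bigr do rewrite !mxE -big_split /=.
pose F (y : L) j := m (val y) ((enum_val p : conf L) y) j *
                    m' (val y) j ((enum_val q : conf L) y).
rewrite (sum_conf R L (fun f => \prod_(y : L) F y (f y))) -(bigA_distr_bigA F).
by apply: eq_bigr => y _; rewrite mxE.
Qed.

Lemma prod_bool_eq (R : realType) (T : finType) (P : pred T) :
  \prod_(y : T) (P y)%:R = [forall y, P y]%:R :> R[i].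
Proof.
case: (boolP [forall y, P y]) => [/forallP h|/forallPn [y hy]].
  by rewrite big1 // => y _; rewrite h.
by rewrite (bigD1 y) //= (negPf hy) mul0r.
Qed.

Lemma eq_tensor (R : realType) (L : {fset vertex}) (m m' : vertex -> 'M[R[i]]_2) :
  {in L, m =1 m'} -> tensor L m = tensor L m'.
Proof.
move=> e; apply/matrixP => p q; rewrite !mxE.
by apply: eq_bigr => y _; rewrite e //; exact: fsvalP.
Qed.

Lemma tensor1 (R : realType) (L : {fset vertex}) :
  tensor L (fun=> 1%:M) = 1 :> loc R L.
Proof.
apply/matrixP => p q; rewrite !mxE.
under eq_bigr do rewrite mxE.
rewrite prod_bool_eq; congr (_%:R); congr nat_of_bool.
rewrite -(inj_eq enum_val_inj); apply/forallP/eqP => [h|-> //].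
by apply/ffunP => y; apply/eqP.
Qed.

Lemma adj_tensor (R : realType) (L : {fset vertex}) (m : vertex -> 'M[R[i]]_2) :
  adjmx (tensor L m) = tensor L (fun y => adjmx (m y)).
Proof.
by apply/matrixP => p q; rewrite !mxE rmorph_prod; apply: eq_bigr => y _; rewrite !mxE.
Qed.

Lemma siteM (R : realType) (L : {fset vertex}) y (a b : 'M[R[i]]_2) :
  site L y a * site L y b = site L y (a * b).
Proof. by rewrite tensorM; apply: eq_tensor => z _ /=; case: eqP; rewrite ?mulr1. Qed.

Lemma site1 (R : realType) (L : {fset vertex}) y : site L y 1 = 1 :> loc R L.
Proof. by rewrite -(tensor1 R L); apply: eq_tensor => z _; case: eqP. Qed.

Lemma site_comm (R : realType) (L : {fset vertex}) x y (a b : 'M[R[i]]_2) :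
  x != y -> site L x a * site L y b = site L y b * site L x a.
Proof.
move=> xy; rewrite !tensorM; apply: eq_tensor => z _ /=.
case: eqP => [->|_]; last by case: eqP; rewrite ?mulr1 ?mul1r.
by rewrite (negPf xy) mulr1 mul1r.
Qed.

Lemma site_linear (R : realType) (L : {fset vertex}) y :
  y \in L -> linear (@site R L y).
Proof.
move=> yL c a b; apply/matrixP => p q; rewrite !mxE.
have E (a0 : 'M[R[i]]_2) : \prod_(z : L) (if val z == y then a0 else 1%:M)
      ((enum_val p : conf L) z) ((enum_val q : conf L) z) =
    a0 ((enum_val p : conf L) [` yL]) ((enum_val q : conf L) [` yL]) *
    \prod_(z : L | z != [` yL]) (1%:M : 'M[R[i]]_2)
      ((enum_val p : conf L) z) ((enum_val q : conf L) z).
  rewrite (bigD1 [` yL] isT); congr (_ * _); last first.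
    by apply: eq_bigr => z hz; rewrite ifN.
  by rewrite ifT.
by rewrite !E mulrA -mulrDl !mxE.
Qed.

Lemma site0 (R : realType) (L : {fset vertex}) y : y \in L ->
  site L y (0 : 'M[R[i]]_2) = 0.
Proof.
move=> yL; have := site_linear R L y yL (-1) 0 0.
by rewrite scaler0 addr0 scaleN1r addNr.
Qed.

Lemma siteZ (R : realType) (L : {fset vertex}) y (c : R[i]) (a : 'M[R[i]]_2) : y \in L ->
  site L y (c *: a) = c *: site L y a.
Proof. by move=> yL; have := site_linear R L y yL c a 0; rewrite site0 // !addr0. Qed.

Lemma siteD (R : realType) (L : {fset vertex}) y (a b : 'M[R[i]]_2) : y \in L ->
  site L y (a + b) = site L y a + site L y b.
Proof. by move=> yL; have := site_linear R L y yL 1 a b; rewrite !scale1r. Qed.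

Lemma site_sum (R : realType) (L : {fset vertex}) y (I : Type) (r : seq I)
    (F : I -> 'M[R[i]]_2) : y \in L ->
  site L y (\sum_(k <- r) F k) = \sum_(k <- r) site L y (F k).
Proof.
move=> yL; apply: (big_morph (@site R L y)); last exact: site0.
by move=> a b; exact: siteD.
Qed.

Lemma adj_site (R : realType) (L : {fset vertex}) y (a : 'M[R[i]]_2) :
  adjmx (site L y a) = site L y (adjmx a).
Proof.
rewrite adj_tensor; apply: eq_tensor => z _; case: eqP => // _.
by rewrite /adjmx trmx1 map_mx1.
Qed.

(** The order of the factors is immaterial, so any duplicate-free enumeration
    of the sites gives the same tensor. *)
Lemma prod_site (R : realType) (L : {fset vertex}) (s : seq vertex) (m : vertex -> 'M[R[i]]_2) :
  uniq s -> \prod_(y <- s) site L y (m y) = tensor L (fun y => if y \in s then m y else 1).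
Proof.
elim: s => [_|x s IH /= /andP[xs us]].
  by rewrite big_nil -(tensor1 R L); apply: eq_tensor.
rewrite big_cons IH // tensorM; apply: eq_tensor => z _.
rewrite inE; case: eqP => [->|_]; last by rewrite mul1r.
by rewrite (negPf xs) mulr1.
Qed.

Lemma tensor_prod_site (R : realType) (L : {fset vertex}) (m : vertex -> 'M[R[i]]_2) :
  tensor L m = \prod_(y <- L) site L y (m y).
Proof. by rewrite prod_site ?fset_uniq //; apply: eq_tensor => y ->. Qed.

(** Total extension of a configuration. With it the entries of tensors over
    different finite sets become products over sequences of vertices, and
    conf_restrict only shortens the sequence. *)
Definition conf_total {L : {fset vertex}} (p : conf L) (v : vertex) : 'I_2 :=
  if insub v is Some z then p z else ord0.

Lemma conf_totalE (L : {fset vertex}) (p : conf L) (y : L) : conf_total p (val y) = p y.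
Proof. by rewrite /conf_total valK. Qed.

Lemma conf_total_restrict (L L' : {fset vertex}) (p : conf L') v :
  v \in L -> conf_total (conf_restrict L p) v = conf_total p v.
Proof. by move=> vL; rewrite -[v]/(val [` vL]) conf_totalE ffunE. Qed.

Lemma tensor_entry (R : realType) (L : {fset vertex}) (m : vertex -> 'M[R[i]]_2) p q :
  tensor L m p q = \prod_(y <- L) m y (conf_total (enum_val p) y) (conf_total (enum_val q) y).
Proof.
rewrite mxE big_seq_fsetE /=; apply: eq_bigr => y _.
by rewrite !conf_totalE.
Qed.

Lemma loc_extend_tensor (R : realType) (L L' : {fset vertex}) (m : vertex -> 'M[R[i]]_2) :
  L `<=` L' -> (forall y, y \notin L -> m y = 1) ->
  loc_extend L' (tensor L m) = tensor L' m.
Proof.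
move=> sLL m1; apply/matrixP => p q; rewrite mxE !tensor_entry !enum_rankK.
rewrite [RHS](bigID (mem L)) /=; congr (_ * _).
  rewrite -[RHS]big_filter.
  have h : perm_eq L [seq i <- L' | i \in L].
    apply: uniq_perm; rewrite ?fset_uniq ?filter_uniq ?fset_uniq // => v.
    by rewrite mem_filter; case: (boolP (v \in L)) => //= vL; rewrite (fsubsetP sLL).
  rewrite -(perm_big _ h) /= !big_seq; apply: eq_bigr => v vL.
  by rewrite !conf_total_restrict.
rewrite -prod_bool_eq big_seq_fsetE big_mkcond /=.
rewrite [RHS]big_mkcond; apply: eq_bigr => y _ /=.
case: ifP => // yL.
by rewrite m1 // mxE !conf_totalE /=.
Qed.

Lemma loc_extend_linear (R : realType) (L L' : {fset vertex}) :
  linear (@loc_extend R L L').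
Proof. by move=> c a b; apply/matrixP => p q; rewrite !mxE mulrDl mulrA. Qed.

Lemma loc_extend_site (R : realType) (L L' : {fset vertex}) y (a : 'M[R[i]]_2) :
  L `<=` L' -> y \in L -> loc_extend L' (site L y a) = site L' y a.
Proof.
move=> sLL yL; apply: loc_extend_tensor => // z zL.
by case: eqP zL => // ->; rewrite yL.
Qed.

Lemma delta_tensor (R : realType) (L : {fset vertex}) (p q : 'I_#|{: conf L}|) :
  delta_mx p q = tensor L (fun y => delta_mx (conf_total (enum_val p) y)
                                             (conf_total (enum_val q) y)) :> loc R L.
Proof.
apply/matrixP => p' q'; rewrite !mxE.
under [RHS]eq_bigr do rewrite mxE !conf_totalE.
rewrite prod_bool_eq; congr (_%:R); congr nat_of_bool.
apply/andP/forallP => [[/eqP-> /eqP->] y|h]; first by rewrite !eqxx.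
by split; apply/eqP/enum_val_inj/ffunP => y; have /andP[/eqP h1 /eqP h2] := h y.
Qed.

(** The matrix units of B_L are elementary tensors, so these span B_L. The
    matrices off L do not enter in the tensor and can be taken to be 1. *)
Lemma loc_ind (R : realType) (L : {fset vertex}) (P : loc R L -> Prop) :
  P 0 -> (forall c a b, P a -> P b -> P (c *: a + b)) ->
  (forall m : vertex -> 'M[R[i]]_2, (forall y, y \notin L -> m y = 1) -> P (tensor L m)) ->
  forall a, P a.
Proof.
move=> P0 PD Pt a.
have Pd p q : P (delta_mx p q).
  rewrite delta_tensor (@eq_tensor _ _ _ (fun y => if y \in L then
    delta_mx (conf_total (enum_val p) y) (conf_total (enum_val q) y) else 1));
    last by move=> y ->.
  by apply: Pt => y /negPf ->.
rewrite (matrix_sum_delta a); elim/big_ind: _ => // [x y Px Py|p _].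
  by rewrite -[x]scale1r; apply: PD.
elim/big_ind: _ => // [x y Px Py|q _].
  by rewrite -[x]scale1r; apply: PD.
by rewrite -[_ *: _]addr0; apply: PD.
Qed.

(** * The normalized trace *)

Lemma ntrC (R : realType) n (a b : 'M[R[i]]_n) : ntr (a * b) = ntr (b * a).
Proof. by rewrite /ntr; congr (_ / _); apply: mxtrace_mulC. Qed.

Lemma ntr_linear (R : realType) n : scalar (@ntr R n).
Proof. by move=> c a b; rewrite /ntr mxtraceD mxtraceZ mulrDl mulrA. Qed.
HB.instance Definition _ (R : realType) n :=
  GRing.isLinear.Build R[i] 'M[R[i]]_n R[i] _ (@ntr R n) (@ntr_linear R n).

(** The operators supported off y form the commutant of B_y. This description
    is stable under products and adjoints, and spares explicit supports. *)
Definition commutes_at {R : realType} {L : {fset vertex}} (y : vertex) (V : loc R L) :=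
  forall b : 'M[R[i]]_2, V * site L y b = site L y b * V.

(** Traciality alone makes the trace factor: moving a matrix unit e_0j through
    V shows that the trace of V e_ij vanishes for i <> j and does not depend on
    i = j, and the diagonal units sum to 1. *)
Lemma ntr_site (R : realType) (L : {fset vertex}) y (V : loc R L) (b : 'M[R[i]]_2) :
  y \in L -> commutes_at y V -> ntr (V * site L y b) = ntr b * ntr V.
Proof.
move=> yL cV.
have [f [fE fL]] : exists f : 'M[R[i]]_2 -> R[i],
    (forall a, ntr (V * site L y a) = f a) /\ scalar f.
  eexists; split=> // c a a'; rewrite (site_linear R L y yL) mulrDr -ntr_linear.
  by congr (ntr (_ + _)); exact/esym/scalemxAr.
have f0 : f 0 = 0 by have := fL (-1) 0 0; rewrite scaler0 addr0 mulN1r addNr.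
have fZ c a : f (c *: a) = c * f a by have := fL c a 0; rewrite f0 !addr0.
have fD a a' : f (a + a') = f a + f a' by have := fL 1 a a'; rewrite scale1r mul1r.
have fsum (F : 'I_2 -> 'M[R[i]]_2) : f (\sum_i F i) = \sum_i f (F i).
  exact: (big_morph f fD f0).
have e i j : f (delta_mx i j) = (i == j)%:R * f (delta_mx 0 0).
  have -> : delta_mx i j = delta_mx i 0 * delta_mx 0 j :> 'M[R[i]]_2.
    by rewrite -[RHS]/(_ *m _) mul_delta_mx.
  rewrite -!fE -siteM mulrA ntrC mulrA -cV -mulrA siteM fE.
  rewrite -[_ * delta_mx _ _]/(_ *m _) mul_delta_mx_cond eq_sym.
  by case: eqP => _; rewrite ?mul1r // mulr0n f0 mul0r.
have hV : ntr V = 2 * f (delta_mx 0 0).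
  rewrite -[V in LHS]mulr1 -(site1 R L y) fE -[1]/(1%:M) mx1_sum_delta fsum.
  by rewrite big_ord_recl big_ord1 [X in _ + X]e eqxx mul1r mulr_natl mulr2n.
rewrite fE {1}(matrix_sum_delta b) fsum.
under eq_bigr => i _ do (rewrite fsum; under eq_bigr => j _ do rewrite fZ e).
rewrite hV /ntr /mxtrace mulrA divfK ?pnatr_eq0 // mulr_suml.
apply: eq_bigr => i _; rewrite (bigD1 i) //= eqxx mul1r big1 ?addr0 // => j ji.
by rewrite eq_sym (negPf ji) mul0r mulr0.
Qed.

(** * Unital C*-algebras and their states *)

Lemma normc_real (R : realType) (t : R) : `|t%:C : R[i]| = `|t|%:C.
Proof. by rewrite normc_def expr0n addr0 sqrtr_sqr. Qed.

Section CStarFacts.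
Context {R : realType} {A : cstarAlgType R}.
Implicit Types (a b x y z : A).

Lemma cnormZR (t : R) a : cnorm (t%:C *: a) = `|t| * cnorm a.
Proof. by apply: (@complexI R); rewrite cnormZ normc_real rmorphM. Qed.

Lemma cnorm0 : cnorm (0 : A) = 0.
Proof. by rewrite -(scale0r (0 : A)) -[0 in LHS](rmorph0 (real_complex R)) cnormZR normr0 mul0r. Qed.

Lemma cnormN a : cnorm (- a) = cnorm a.
Proof. by rewrite -scaleN1r -(rmorphN1 (real_complex R)) cnormZR normrN1 mul1r. Qed.

Lemma cnorm_ge0 a : 0 <= cnorm a.
Proof. by have := cnormD a (- a); rewrite subrr cnorm0 cnormN; lra. Qed.

Lemma cnorm_distC a b : cnorm (a - b) = cnorm (b - a).
Proof. by rewrite -cnormN opprB. Qed.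

Lemma cnorm_starE a : cnorm (star a) = cnorm a.
Proof.
have le b : cnorm b <= cnorm (star b).
  have := cnorm_star b; have := cnormM (star b) b; have := cnorm_ge0 b; have := cnorm_ge0 (star b).
  nra.
by apply/eqP; rewrite eq_le le -{2}(starK a) le.
Qed.

Lemma star0 : star (0 : A) = 0.
Proof. by apply: (addrI (star (0 : A))); rewrite -starD !addr0. Qed.

Lemma star1 : star (1 : A) = 1.
Proof. by have := starM (star (1 : A)) 1; rewrite starK !mulr1 starK. Qed.

Lemma starN a : star (- a) = - star a.
Proof. by apply: (addrI (star a)); rewrite -starD !subrr star0. Qed.

Lemma starB a b : star (a - b) = star a - star b.
Proof. by rewrite starD starN. Qed.

Lemma starZR (t : R) a : star (t%:C *: a) = t%:C *: star a.
Proof. by rewrite starZ; congr (_ *: _); exact: conjc_real. Qed.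

(** A fixed point r of this map satisfies (1 - r)^2 = 1 - z. *)
Definition sqrt_step z x : A := (2^-1 : R)%:C *: (z + x * x).

Lemma sqrt_step_bound z x :
  cnorm z <= 3 / 4 -> cnorm x <= 1 / 2 -> cnorm (sqrt_step z x) <= 1 / 2.
Proof.
move=> hz hx; rewrite cnormZR ger0_norm //.
by have := cnormD z (x * x); have := cnormM x x; have := cnorm_ge0 x; nra.
Qed.

Lemma sqrt_step_lip z x y :
  cnorm (sqrt_step z x - sqrt_step z y) <=
  (cnorm x + cnorm y) / 2 * cnorm (x - y).
Proof.
rewrite -scalerBr cnormZR ger0_norm //.
have -> : z + x * x - (z + y * y) = (x - y) * x + y * (x - y).
  by rewrite mulrBl mulrBr opprD addrACA subrr add0r addrA subrK.
have := cnormD ((x - y) * x) (y * (x - y)).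
have := cnormM (x - y) x; have := cnormM y (x - y).
nra.
Qed.

(** For a small z the map sqrt_step z is a contraction of the ball of radius
    1/2; its iterates from 0 are self-adjoint, and their limit r gives y = 1 - r. *)
Lemma one_minus_is_square z : star z = z -> cnorm z <= 3 / 4 ->
  exists2 y : A, star y = y & 1 - z = y * y.
Proof.
move=> sz hz.
pose r n := iter n (sqrt_step z) 0.
have rS n : r n.+1 = sqrt_step z (r n) by [].
have hr n : cnorm (r n) <= 1 / 2.
  elim: n => [|n IH]; first by rewrite /r /= cnorm0.
  exact: sqrt_step_bound.
have cau n k : cnorm (r (n + k)%N - r n) <= 1 / 2 * (1 / 2) ^+ n.
  elim: n => [|n IH]; first by rewrite add0n subr0 expr0 mulr1.
  rewrite addSn !rS exprS mulrCA; apply: le_trans (sqrt_step_lip _ _ _) _.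
  apply: ler_pM => //; rewrite ?cnorm_ge0 ?divr_ge0 ?addr_ge0 ?cnorm_ge0 //.
  by have := hr (n + k)%N; have := hr n; lra.
have small (e : R) : 0 < e -> exists N, (1 / 2) ^+ N < e.
  move=> e0.
  have /cvgrPdist_lt /(_ e e0) [N _ /(_ N (leqnn N))] /= : (fun n => (1 / 2 : R) ^+ n) @ \oo --> 0.
    by apply: cvg_expr; rewrite ger0_norm //; lra.
  rewrite sub0r normrN ger0_norm ?exprn_ge0 // => h.
  by exists N.
have [l hl] : exists l : A, (fun n => cnorm (r n - l)) @ \oo --> (0 : R).
  apply: cnorm_complete => e e0.
  have [N hN] := small e e0.
  exists N => m n Nm Nn.
  have := cnormD (r m - r N) (r N - r n).
  rewrite addrA subrK (cnorm_distC (r N)).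
  have := cau N (m - N)%N; have := cau N (n - N)%N; rewrite !subnKC //.
  by move: hN; set t := _ ^+ N; lra.
(* Vanishing through approximation: the distances from the iterates to
   the limit l are arbitrarily small. *)
have near0 x : (forall e, 0 < e -> exists n,
    cnorm x <= e + cnorm (r n - l) * 4 /\ cnorm (r n - l) < e) -> x = 0.
  move=> h; apply: cnorm_eq0; apply/eqP; rewrite eq_le cnorm_ge0 andbT.
  apply/ler_addgt0Pl => e e0; have e5 : 0 < e / 5 by lra.
  by have [n []] := h _ e5; lra.
have ev (e : R) : 0 < e -> exists N, forall n, (N <= n)%N -> cnorm (r n - l) < e.
  move=> e0; have /cvgrPdist_lt /(_ e e0) [N _ hN] := hl.
  exists N => n Nn; have := hN n Nn.
  by rewrite /= sub0r normrN ger0_norm ?cnorm_ge0.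
have lS : l = sqrt_step z l.
  apply/subr0_eq/near0 => e e0.
  have [N hN] := ev _ e0; exists N.+1; split; last exact: hN.
  have hl1 : cnorm l <= 1.
    have [N' /(_ N' (leqnn _))] := ev (1/2) (ltac:(lra)).
    have := cnormD (r N') (l - r N'); rewrite subrKC (cnorm_distC l).
    by have := hr N'; lra.
  have hN0 := hN N (leqnn _).
  have := cnormD (l - r N.+1) (r N.+1 - sqrt_step z l).
  rewrite addrA subrK (cnorm_distC l) rS.
  have : cnorm (sqrt_step z (r N) - sqrt_step z l) <= cnorm (r N - l).
    apply: le_trans (sqrt_step_lip _ _ _) _; rewrite ler_piMl ?cnorm_ge0 //.
    by have := hr N; lra.
  by have := cnorm_ge0 (sqrt_step z (r N) - l); lra.
have sr n : star (r n) = r n.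
  elim: n => [|n IH]; first by rewrite /r /= star0.
  by rewrite rS /sqrt_step starZR starD starM IH sz.
have sl : star l = l.
  apply/subr0_eq/near0 => e e0.
  have [N hN] := ev _ e0; exists N; split; last exact: hN.
  have := cnormD (star (l - r N)) (r N - l).
  rewrite starB sr addrA subrK -{1}(sr N) -starB cnorm_starE (cnorm_distC l).
  by have := cnorm_ge0 (r N - l); lra.
exists (1 - l); first by rewrite starB star1 sl.
rewrite mulrBl mul1r mulrBr mulr1.
have -> : z = l + l - l * l.
  apply: (addIr (l * l)); rewrite subrK {3 4}lS /sqrt_step -scalerDl -rmorphD /=.
  by rewrite (_ : 2^-1 + 2^-1 = 1) ?scale1r //; lra.
by rewrite !opprB opprD addrA [RHS]addrACA.
Qed.

End CStarFacts.

Section States.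
Context {R : realType} {A : cstarAlgType R} (phi : A -> R[i]) (hphi : is_state phi).

Lemma state0 : phi 0 = 0.
Proof. by have := state_linear hphi (-1) 0 0; rewrite scaler0 addr0 mulN1r addNr. Qed.

Lemma stateZ (c : R[i]) a : phi (c *: a) = c * phi a.
Proof. by have := state_linear hphi c a 0; rewrite state0 !addr0. Qed.

Lemma stateD a b : phi (a + b) = phi a + phi b.
Proof. by have := state_linear hphi 1 a b; rewrite scale1r mul1r. Qed.

Lemma stateB a b : phi (a - b) = phi a - phi b.
Proof. by rewrite -scaleN1r stateD stateZ mulN1r. Qed.

(** Positivity of phi on the square 1 - star x * x. *)
Lemma state_star_le1 (x : A) : cnorm x <= 1 / 2 -> phi (star x * x) <= 1.
Proof.
move=> hx; have [||y sy hy] := @one_minus_is_square R A (star x * x).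
- by rewrite starM starK.
- by rewrite cnorm_star; have := cnorm_ge0 x; nra.
have := state_pos hphi y; rewrite sy -hy stateB (state_1 hphi).
by rewrite subr_ge0.
Qed.

(** The polarization identity writes 4 phi (star y * x) as a combination, with
    coefficients of modulus 1, of the values of phi at four positive elements;
    the sum of these values is the right-hand side, times 4. *)
Lemma state_polarization (x y : A) :
  `|phi (star y * x)| <= phi (star x * x) + phi (star y * y).
Proof.
pose q (c : R[i]) := phi (star (x + c *: y) * (x + c *: y)).
have q0 c : 0 <= q c by exact: state_pos.
have qE c : q c = phi (star x * x) + c * phi (star x * y) + c^* * phi (star y * x)
   + c^* * c * phi (star y * y).
  rewrite /q starD starZ mulrDl !mulrDr -!scalerAl -!scalerAr !scalerA.
  by rewrite !stateD !stateZ addrA.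
have ii : 'i * 'i = -1 :> R[i] by rewrite -expr2 sqr_i.
have c1 : @Num.conj R[i] (1) = 1 by exact: rmorph1.
have cN1 : @Num.conj R[i] (-1) = -1 by exact: rmorphN1.
have ci : @Num.conj R[i] ('i) = - 'i by apply/eqP; rewrite eq_complex /= oppr0 !eqxx.
have cNi : @Num.conj R[i] (- 'i) = 'i by apply/eqP; rewrite eq_complex /= oppr0 opprK !eqxx.
have e1 : 4 * phi (star y * x) = q 1 + 'i * q 'i - q (-1) - 'i * q (- 'i).
  rewrite !qE c1 cN1 ci cNi.
  suff h (a' b' c' d' i : R[i]) : i * i = -1 ->
      4 * c' = a' + 1 * b' + 1 * c' + 1 * 1 * d'
        + i * (a' + i * b' + - i * c' + - i * i * d')
        - (a' + -1 * b' + -1 * c' + -1 * -1 * d')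
        - i * (a' + - i * b' + i * c' + i * - i * d') by exact: h.
  move=> hi; apply/subr0_eq.
  transitivity ((i * i + 1) * (2 * c' - 2 * b')); first by ring.
  by rewrite hi addNr mul0r.
have e2 : q 1 + q 'i + q (-1) + q (- 'i) = 4 * (phi (star x * x) + phi (star y * y)).
  rewrite !qE c1 cN1 ci cNi.
  suff h (a' b' c' d' i : R[i]) : i * i = -1 ->
      a' + 1 * b' + 1 * c' + 1 * 1 * d' + (a' + i * b' + - i * c' + - i * i * d')
        + (a' + -1 * b' + -1 * c' + -1 * -1 * d')
        + (a' + - i * b' + i * c' + i * - i * d') = 4 * (a' + d') by exact: h.
  move=> hi; apply/subr0_eq.
  transitivity ((i * i + 1) * (-2 * d')); first by ring.
  by rewrite hi addNr mul0r.
have ni : `|'i : R[i]| = 1 by exact: normCi.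
have n1 c : `|q c| = q c by apply: ger0_norm.
have h : `|4 * phi (star y * x)| <= q 1 + q 'i + q (-1) + q (- 'i).
  rewrite e1.
  apply: le_trans (ler_normB _ _) _; rewrite normrM ni mul1r n1 lerD2r.
  apply: le_trans (ler_normB _ _) _; rewrite n1 lerD2r.
  apply: le_trans (ler_normD _ _) _; rewrite normrM ni mul1r !n1.
  by [].
move: h; rewrite e2 normrM ger0_norm ?ler0n // ler_pM2l //.
Qed.

End States.

(** * Square roots and exponentials of matrices *)

Lemma adjmxM (R : realType) (m n p : nat) (a : 'M[R[i]]_(m, n)) (b : 'M[R[i]]_(n, p)) :
  adjmx (a *m b) = adjmx b *m adjmx a.
Proof. by rewrite /adjmx trmx_mul map_mxM. Qed.

Lemma adjmxK (R : realType) (m n : nat) (a : 'M[R[i]]_(m, n)) :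
  adjmx (adjmx a) = a.
Proof. by apply/matrixP => i j; rewrite !mxE conjCK. Qed.

Lemma conj_real (R : realType) (t : R) : @Num.conj R[i] t%:C = t%:C.
Proof. exact: conjc_real. Qed.

Lemma adjmx_scalar (R : realType) n (t : R) :
  adjmx (t%:C%:M : 'M[R[i]]_n) = t%:C%:M.
Proof. by rewrite /adjmx tr_scalar_mx map_scalar_mx; congr (_%:M); exact: conj_real. Qed.

Lemma mul_adjE (R : realType) n (v : 'rV[R[i]]_n) :
  (v *m adjmx v) 0 0 = \sum_j `|v 0 j| ^+ 2.
Proof. by rewrite mxE; apply: eq_bigr => j _; rewrite !mxE normCK. Qed.

Lemma mul_adj_ge0 (R : realType) n (v : 'rV[R[i]]_n) : 0 <= (v *m adjmx v) 0 0.
Proof. by rewrite mul_adjE sumr_ge0 // => j _; rewrite exprn_ge0. Qed.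

Lemma mul_adj_eq0 (R : realType) n (v : 'rV[R[i]]_n) : (v *m adjmx v) 0 0 = 0 -> v = 0.
Proof.
rewrite mul_adjE => /psumr_eq0P h; apply/rowP => j; rewrite mxE.
by apply/eqP; rewrite -normr_eq0 -sqrf_eq0 h // => k _; rewrite exprn_ge0.
Qed.

(** Uniqueness of the root: if b is positive and b^2 = t, then
    (b - s)(b + s) = 0 for s the square root of t, and b + s is injective because
    v b v* + s v v* = 0 forces v = 0. *)
Lemma sqrtmx_scalar (R : realType) n (t : R) : 0 < t ->
  sqrtmx (t%:C%:M : 'M[R[i]]_n) = (Num.sqrt t)%:C%:M.
Proof.
move=> t0; have s0 : 0 < Num.sqrt t by rewrite sqrtr_gt0.
have ss : (Num.sqrt t)%:C%:M *m (Num.sqrt t)%:C%:M = t%:C%:M :> 'M[R[i]]_n.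
  by rewrite -scalar_mxM -rmorphM /= -expr2 sqr_sqrtr // ltW.
apply: xget_unique.
  split=> //; exists ((Num.sqrt (Num.sqrt t))%:C%:M).
  by rewrite adjmx_scalar -scalar_mxM -rmorphM /= -expr2 sqr_sqrtr // ltW.
move=> b [[c bE] bb].
have free : row_free (b + (Num.sqrt t)%:C%:M).
  apply: inj_row_free => v hv; apply: mul_adj_eq0.
  have : (v *m b *m adjmx v) 0 0 + (Num.sqrt t)%:C * (v *m adjmx v) 0 0 = 0.
    transitivity ((v *m (b + (Num.sqrt t)%:C%:M) *m adjmx v) 0 0).
      by rewrite mulmxDr mulmxDl mul_mx_scalar -scalemxAl [RHS]mxE [X in _ = _ + X]mxE.
    by rewrite hv mul0mx mxE.
  have -> : v *m b *m adjmx v = (v *m adjmx c) *m adjmx (v *m adjmx c).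
    by rewrite adjmxM adjmxK bE !mulmxA.
  move=> /eqP; rewrite paddr_eq0 ?mul_adj_ge0 //; last first.
    by rewrite mulr_ge0 ?mul_adj_ge0 // lecR ltW.
  move=> /andP[_]; rewrite mulf_eq0 => /orP[|/eqP //].
  by rewrite eq_complex /= gt_eqF.
apply/eqP; rewrite -subr_eq0; apply/eqP.
apply: (row_free_inj free); rewrite mul0mx mulmxDr !mulmxBl ss.
rewrite mul_mx_scalar mul_scalar_mx.
by rewrite bb addrA subrK subrr.
Qed.

Lemma posc_real (R : realType) (e : R[i]) : 0 < e -> exists2 r : R, 0 < r & e = r%:C.
Proof. by case: e => er ei; rewrite ltcE /= => /andP[/eqP -> r0]; exists er. Qed.

Lemma cvg_real_complex (R : realType) (u : nat -> R) (l : R) :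
  u @ \oo --> l -> (fun n => (u n)%:C : R[i]^o) @ \oo --> (l%:C : R[i]^o).
Proof.
move=> /cvgrPdist_lt h; apply/cvgrPdist_lt => e /posc_real [r r0 ->].
have := h r r0; apply: filterS => n /= hn.
by rewrite -rmorphB normc_real ltcR.
Qed.

Lemma cvg_exp_series (R : realType) (b : R) :
  (fun N => (series (exp_coeff b) N.+1)%:C : R[i]^o) @ \oo --> ((expR b)%:C : R[i]^o).
Proof.
apply: cvg_real_complex; rewrite (cvg_shiftS (series (exp_coeff b))).
exact: is_cvg_series_exp_coeff.
Qed.

(** When H^3 = H, the matrices (H^2 + H) / 2 and (H^2 - H) / 2 are
    eigenmatrices of the multiplication by H, for 1 and -1; the exponential series
    splits into the real exponential series at b and -b. *)
Lemma expmx_cubic (R : realType) n (b : R) (H : 'M[R[i]]_n) : H * H * H = H ->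
  expmx (b%:C *: H) =
  1 + (cosh b - 1)%:C *: (H * H) + ((expR b - expR (- b)) / 2)%:C *: H.
Proof.
move=> H3.
have [Qp [Qm [HQp HQm comb]]] : exists Qp Qm : 'M[R[i]]_n,
  [/\ H *m Qp = Qp, H *m Qm = - Qm &
   forall x y : R[i], x *: Qp + y *: Qm =
     (2^-1 * (x + y)) *: (H * H) + (2^-1 * (x - y)) *: H].
  have HHH : H *m (H * H) = H by rewrite -[LHS]/(H * (H * H)) mulrA.
  exists (2^-1 *: (H * H + H)), (2^-1 *: (H * H - H)); split.
  - by rewrite -scalemxAr mulmxDr HHH addrC.
  - by rewrite -scalemxAr mulmxBr HHH -scalerN opprB.
  move=> x y; rewrite scalerBr !scalerDr !scalerN !scalerA addrACA -scalerDl -scalerBl.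
  by congr (_ *: _ + _ *: _); ring.
have mulHD (x y z : R[i]) (U V : 'M[R[i]]_n) :
    (x *: H) * (y *: U + z *: V) = x *: (y *: (H *m U)) + x *: (z *: (H *m V)).
  by rewrite -[LHS]/(_ *m _) mulmxDr -!scalemxAl -!scalemxAr.
have HQ k (c : R) : (c%:C *: H) ^+ k.+1 = (c ^+ k.+1)%:C *: Qp + ((- c) ^+ k.+1)%:C *: Qm.
  elim: k => [|k IH].
    rewrite !expr1 comb rmorphN /= addrN mulr0 scale0r add0r opprK.
    by congr (_ *: _); field.
  rewrite exprS IH mulHD HQp HQm !scalerN !scalerA.
  rewrite [c ^+ k.+2]exprS [(- c) ^+ k.+2]exprS !rmorphM /= rmorphN /=.
  by rewrite mulNr scaleNr.
have h0 : 1 = Qp + Qm + (1 - H * H).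
  have := comb 1 1; rewrite !scale1r => ->; rewrite subrr mulr0 scale0r addr0.
  by rewrite -(natrD _ 1 1) mulVf ?pnatr_eq0 // scale1r subrKC.
have hs N : series (fun k => (k`!%:R : R[i])^-1 *: (b%:C *: H) ^+ k : 'M[R[i]^o]_n) N.+1 =
   (series (exp_coeff b) N.+1)%:C *: Qp + (series (exp_coeff (- b)) N.+1)%:C *: Qm + (1 - H * H).
  elim: N => [|N IH].
    rewrite !seriesSr !seriesEnat /= !big_geq // /exp_coeff /= !expr0 fact0 !add0r invr1 divr1.
    by rewrite !scale1r.
  have expS (c : R) : (series (exp_coeff c) N.+2)%:C =
      (series (exp_coeff c) N.+1)%:C + (N.+1`!%:R : R[i])^-1 * (c ^+ N.+1)%:C.
    rewrite seriesSr rmorphD; congr (_ + _).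
    by rewrite /exp_coeff /= mulrC rmorphM fmorphV rmorph_nat.
  rewrite seriesSr IH !expS !scalerDl HQ scalerDr !scalerA.
  move: (_ *: Qp) (_ *: Qm) (1 - _) => U V W.
  by rewrite addrAC; congr (_ + _); rewrite addrACA.
rewrite /expmx; have hd := @norm_hausdorff _ ('M[R[i]^o]_n : normedModType R[i]).
apply: (cvg_lim hd).
rewrite -(cvg_shiftS _) /=.
have -> : 1 + (cosh b - 1)%:C *: (H * H) + ((expR b - expR (- b)) / 2)%:C *: H =
    (expR b)%:C *: Qp + (expR (- b))%:C *: Qm + (1 - H * H).
  have -> : ((expR b - expR (- b)) / 2)%:C = 2^-1 * ((expR b)%:C - (expR (- b))%:C) :> R[i].
    by rewrite mulrC rmorphM fmorphV rmorph_nat rmorphB.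
  have -> : (cosh b - 1)%:C = 2^-1 * ((expR b)%:C + (expR (- b))%:C) - 1 :> R[i].
    by rewrite /cosh mulrC rmorphB rmorphM fmorphV rmorph_nat rmorphD.
  rewrite comb scalerBl scale1r.
  by rewrite [RHS]addrC [RHS]addrA; congr (_ + _); rewrite addrCA [LHS]addrC.
rewrite (eq_cvg _ _ hs).
pose Q1 : 'M[R[i]^o]_n := Qp; pose Q2 : 'M[R[i]^o]_n := Qm.
apply: (@cvgD _ 'M[R[i]^o]_n); last exact: cvg_cst.
apply: (@cvgD _ 'M[R[i]^o]_n).
  exact: (@cvgZr_tmp _ _ _ _ _ _ _ Q1 (cvg_exp_series R b)).
exact: (@cvgZr_tmp _ _ _ _ _ _ _ Q2 (cvg_exp_series R (- b))).
Qed.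

(** * Balls of the tree and operators supported off a site *)

Lemma mem_tree_sphere n (x : vertex) : (x \in tree_sphere n) = (size x == n).
Proof.
apply/mapP/eqP => [[t _ ->]|h]; first exact: size_tuple.
by exists (Tuple (introT eqP h)); rewrite ?mem_enum.
Qed.

Lemma uniq_tree_sphere n : uniq (tree_sphere n).
Proof. by rewrite map_inj_uniq ?enum_uniq //; exact: val_inj. Qed.

Lemma mem_tree_ball n (x : vertex) : (x \in tree_ball n) = (size x <= n)%N.
Proof.
rewrite /tree_ball in_fset; apply/flatten_mapP/idP => [[m]|h].
  by rewrite mem_iota mem_tree_sphere => /andP[_ h] /eqP ->.
by exists (size x); rewrite ?mem_iota ?mem_tree_sphere.
Qed.

Lemma tree_ball_sub m n : (m <= n)%N -> tree_ball m `<=` tree_ball n.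
Proof. by move=> h; apply/fsubsetP => x; rewrite !mem_tree_ball => /leq_trans; apply. Qed.

Lemma commutes_atM (R : realType) (L : {fset vertex}) y (V W : loc R L) :
  commutes_at y V -> commutes_at y W -> commutes_at y (V * W).
Proof. by move=> hV hW b; rewrite -mulrA hW mulrA hV mulrA. Qed.

Lemma commutes_at_sum (R : realType) (L : {fset vertex}) y I (r : seq I) (F : I -> loc R L) :
  (forall k, commutes_at y (F k)) -> commutes_at y (\sum_(k <- r) F k).
Proof. by move=> h b; rewrite mulr_suml mulr_sumr; apply: eq_bigr => k _; apply: h. Qed.

Lemma commutes_at1 (R : realType) (L : {fset vertex}) y :
  commutes_at y (1 : loc R L).
Proof. by move=> b; rewrite mul1r mulr1. Qed.

Lemma commutes_at_prod (R : realType) (L : {fset vertex}) y (I : eqType) (r : seq I) (F : I -> loc R L) :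
  {in r, forall k, commutes_at y (F k)} -> commutes_at y (\prod_(k <- r) F k).
Proof.
move=> h; rewrite big_seq; elim/big_ind: _ => //; first exact: commutes_at1.
by move=> V W; exact: commutes_atM.
Qed.

Lemma commutes_at_site (R : realType) (L : {fset vertex}) x y (a : 'M[R[i]]_2) :
  x != y -> commutes_at y (site L x a).
Proof. by move=> xy b; exact: site_comm. Qed.

Lemma commutes_at_tensor (R : realType) (L : {fset vertex}) y (m : vertex -> 'M[R[i]]_2) :
  m y = 1 -> commutes_at y (tensor L m).
Proof.
move=> my b; rewrite !tensorM; apply: eq_tensor => z _ /=.
by case: eqP => [->|_]; rewrite ?my ?mulr1 ?mul1r.
Qed.

Lemma adjmxD (R : realType) m n (a b : 'M[R[i]]_(m, n)) : adjmx (a + b) = adjmx a + adjmx b.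
Proof. by apply/matrixP => i j; rewrite !mxE rmorphD. Qed.

Lemma adjmx0 (R : realType) m n : adjmx (0 : 'M[R[i]]_(m, n)) = 0.
Proof. by apply/matrixP => i j; rewrite !mxE rmorph0. Qed.

Lemma adjmx_sum (R : realType) m n I (r : seq I) (F : I -> 'M[R[i]]_(m, n)) :
  adjmx (\sum_(k <- r) F k) = \sum_(k <- r) adjmx (F k).
Proof. by elim/big_rec2: _ => [|k a b _ <-]; rewrite ?adjmx0 ?adjmxD. Qed.

Lemma adjmx_mul (R : realType) n (a b : 'M[R[i]]_n) : adjmx (a * b) = adjmx b * adjmx a.
Proof. exact: adjmxM. Qed.

Lemma loc_extend_sum (R : realType) (L L' : {fset vertex}) I (r : seq I) (F : I -> loc R L) :
  loc_extend L' (\sum_(k <- r) F k) = \sum_(k <- r) loc_extend L' (F k).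
Proof.
have D a b : loc_extend L' (a + b) = loc_extend L' a + loc_extend L' b :> loc R L'.
  by rewrite -{1}(scale1r a) loc_extend_linear scale1r.
have e0 : loc_extend L' (0 : loc R L) = 0.
  by apply: (addrI (loc_extend L' (0 : loc R L))); rewrite -D !addr0.
exact: big_morph.
Qed.

(** * Removing one leaf *)

Section Edge.
Context {R : realType} (C S : R).

(** The coefficients at the upper end x in the decomposition
    K = sum_ij (edge_coef i j)_x (e_ij)_y of the edge operator. *)
Definition edge_coef (i j : 'I_2) : 'M[R[i]]_2 :=
  if i == j then \matrix_(k, l) ((if k == i then 1 else C%:C) *+ (k == l))
  else S%:C *: delta_mx j i.

Definition edge_op (L : {fset vertex}) (x y : vertex) : loc R L :=
  \sum_i \sum_j site L x (edge_coef i j) * site L y (delta_mx i j).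

Lemma adj_edge_coef i j : adjmx (edge_coef i j) = edge_coef j i.
Proof.
rewrite /edge_coef [j == i]eq_sym; case: eqP => [->|_].
  apply/matrixP => k l; rewrite !mxE [l == k]eq_sym; case: (k =P l) => [->|_]; last by rewrite !mulr0n rmorph0.
  by rewrite !mulr1n; case: eqP => _; [exact: rmorph1|exact: conj_real].
apply/matrixP => k l; rewrite !mxE rmorphM /= rmorph_nat andbC; congr (_ * _).
exact: conj_real.
Qed.

Lemma adj_edge_op L x y : x != y -> adjmx (edge_op L x y) = edge_op L x y.
Proof.
move=> xy; rewrite /edge_op adjmx_sum exchange_big /=; apply: eq_bigr => i _.
rewrite adjmx_sum; apply: eq_bigr => j _.
rewrite adjmx_mul !adj_site adj_edge_coef site_comm 1?eq_sym //; congr (_ * site _ _ _).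
by apply/matrixP => k l; rewrite !mxE rmorph_nat andbC.
Qed.

Lemma commutes_at_edge_op L x y z : z != x -> z != y -> commutes_at z (edge_op L x y).
Proof.
move=> zx zy; apply: commutes_at_sum => i; apply: commutes_at_sum => j.
by apply: commutes_atM; apply: commutes_at_site; rewrite eq_sym.
Qed.

Lemma loc_extend_edge_op (L L' : {fset vertex}) x y : L `<=` L' -> x \in L -> y \in L ->
  loc_extend L' (edge_op L x y) = edge_op L' x y.
Proof.
move=> sLL xL yL; rewrite /edge_op loc_extend_sum; apply: eq_bigr => i _.
rewrite loc_extend_sum; apply: eq_bigr => j _; rewrite !tensorM loc_extend_tensor // => z zL.
by rewrite !ifN ?mulr1 //; apply: contraNneq zL => ->.
Qed.

(** Partial trace over y of K (a at x, b at y) K, divided by C^2 so that the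
    identity is reproduced. *)
Definition edge_red (a b : 'M[R[i]]_2) : 'M[R[i]]_2 :=
  (C%:C ^- 2) *: \sum_i \sum_j \sum_k \sum_l
    ntr (delta_mx i j * b * delta_mx k l) *: (edge_coef i j * a * edge_coef k l).

(** By traciality the right factor K moves around the tensor, which is then
    conjugated by K; V and the other factors live off y, so y can be traced out. *)
Lemma edge_trace (L : {fset vertex}) x y (V : loc R L) (m : vertex -> 'M[R[i]]_2) :
  C != 0 -> x != y -> x \in L -> y \in L -> commutes_at y V ->
  ntr (edge_op L x y * V * edge_op L x y * tensor L m) =
  C%:C ^+ 2 * ntr (V * tensor L (fun z => if z == x then edge_red (m x) (m y) else
                             if z == y then 1 else m z)).
Proof.
move=> C0 xy xL yL cV; set K := edge_op L x y.
pose Z := tensor L (fun z => if (z == x) || (z == y) then 1 else m z).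
have eT (a b : 'M[R[i]]_2) : tensor L (fun z => if z == x then a else if z == y then b else m z) =
    site L x a * site L y b * Z.
  rewrite !tensorM; apply: eq_tensor => z _ /=.
  case: eqP => [->|_]; first by rewrite (negPf xy) !mulr1.
  by case: eqP => _; rewrite ?mulr1 ?mul1r.
have Zx : commutes_at x Z by apply: commutes_at_tensor; rewrite eqxx.
have Zy : commutes_at y Z by apply: commutes_at_tensor; rewrite eqxx orbT.
have ZK : Z * K = K * Z.
  rewrite mulr_sumr mulr_suml; apply: eq_bigr => i _.
  rewrite mulr_sumr mulr_suml; apply: eq_bigr => j _.
  by rewrite mulrA Zx -mulrA Zy mulrA.
have -> : tensor L m = site L x (m x) * site L y (m y) * Z.
  by rewrite -eT; apply: eq_tensor => z _; case: eqP => [->|_] //; case: eqP => [->|].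
rewrite eT site1 mulr1.
have -> : ntr (K * V * K * (site L x (m x) * site L y (m y) * Z)) =
          ntr (V * (K * (site L x (m x) * site L y (m y)) * K) * Z).
  by rewrite -!mulrA ntrC -!mulrA ZK.
have hK : K * (site L x (m x) * site L y (m y)) * K =
  \sum_i \sum_j \sum_k \sum_l site L x (edge_coef i j * m x * edge_coef k l) * site L y (delta_mx i j * m y * delta_mx k l).
  rewrite !mulr_suml; apply: eq_bigr => i _; rewrite !mulr_suml; apply: eq_bigr => j _.
  rewrite mulr_sumr; apply: eq_bigr => k _; rewrite mulr_sumr; apply: eq_bigr => l _.
  have cm a b : site L y a * site L x b = site L x b * site L y a.
    by rewrite site_comm // eq_sym.
  have mm a b c d : (site L x a * site L y b) * (site L x c * site L y d) = site L x (a * c) * site L y (b * d).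
    by rewrite -mulrA [_ * (site L x c * _)]mulrA cm -mulrA siteM mulrA siteM.
  by rewrite !mm.
(* Tracing out the site y: the product of V, of the matrix at x and of the
   remaining factors Z is supported off y. *)
have ht a b : ntr (V * (site L x a * site L y b) * Z) = ntr b * ntr (V * site L x a * Z).
  have e : Z * (V * (site L x a * site L y b)) = Z * (V * site L x a) * site L y b.
    by rewrite !mulrA.
  rewrite ntrC e ntr_site //; first by congr (_ * _); rewrite ntrC.
  by do 2!apply: commutes_atM => //; exact: commutes_at_site.
have [T [TE TL]] : exists T : loc R L -> R[i], (forall W, ntr (V * W * Z) = T W) /\ scalar T.
  eexists; split=> // c a b; rewrite mulrDr mulrDl -ntr_linear.
  by congr (ntr (_ + _)); rewrite -[LHS]/(_ *m _ *m _) -scalemxAr -scalemxAl.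
have T0 : T 0 = 0 by have := TL (-1) 0 0; rewrite scaler0 addr0 mulN1r addNr.
have TZ c a : T (c *: a) = c * T a by have := TL c a 0; rewrite T0 !addr0.
have TD a b : T (a + b) = T a + T b by have := TL 1 a b; rewrite scale1r mul1r.
have Tsum (F : 'I_2 -> loc R L) : T (\sum_i F i) = \sum_i T (F i) by exact: (big_morph T TD T0).
rewrite hK mulrA /edge_red siteZ // !TE TZ mulrA mulfV ?mul1r; last by rewrite expf_neq0 // fmorph_eq0.
rewrite site_sum // !Tsum; apply: eq_bigr => i _.
rewrite site_sum // !Tsum; apply: eq_bigr => j _.
rewrite site_sum // !Tsum; apply: eq_bigr => k _.
rewrite site_sum // !Tsum; apply: eq_bigr => l _.
by rewrite siteZ // TZ -!TE ht.
Qed.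

End Edge.

(** * The edge operator and its partial trace *)

Lemma ord2P (i : 'I_2) : i = 0 \/ i = 1.
Proof. by case: i => [[|[|//]] h]; [left|right]; exact: val_inj. Qed.

Definition sinh (R : realType) (t : R) : R := (expR t - expR (- t)) / 2.

(** The products of the four matrix units e i j k l of the edge show that H^2 is
    the projection on the configurations where x and y differ, and H^3 = H. *)
Lemma xyK_edge_op (R : realType) (beta : R) (x y : vertex) : x != y ->
  xyK beta x y = edge_op (cosh beta) (sinh R beta) [fset x; y] x y.
Proof.
move=> xy; set L := [fset x; y].
have xL : x \in L by rewrite !inE eqxx.
have yL : y \in L by rewrite !inE eqxx orbT.
pose e i j k l : loc R L := site L x (delta_mx i j) * site L y (delta_mx k l).
have eM i j k l i' j' k' l' : e i j k l * e i' j' k' l' = e i j' k l' *+ ((j == i') && (k' == l)).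
  have cm a b : site L y a * site L x b = site L x b * site L y a :> loc R L.
    by rewrite site_comm // eq_sym.
  rewrite /e -mulrA [_ * (site L x _ * _)]mulrA cm -mulrA siteM mulrA siteM.
  rewrite -![delta_mx _ _ * delta_mx _ _]/(_ *m _) !mul_delta_mx_cond [k' == l]eq_sym.
  case: (j == i'); last by rewrite !mulr0n (site0 _ _ _ xL) mul0r.
  by case: (l == k'); rewrite ?mulr0n ?mulr1n // (site0 _ _ _ yL) mulr0.
have HE : xyH R x y = e 0 1 1 0 + e 1 0 0 1 by [].
have HH : xyH R x y * xyH R x y = e 0 0 1 1 + e 1 1 0 0.
  by rewrite HE mulrDl !mulrDr !eM /= !mulr0n !mulr1n add0r addr0.
have H3 : xyH R x y * xyH R x y * xyH R x y = xyH R x y.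
  by rewrite HH HE mulrDl !mulrDr !eM /= !mulr0n !mulr1n add0r addr0.
have e1 : 1 = e 0 0 0 0 + e 1 1 0 0 + (e 0 0 1 1 + e 1 1 1 1).
  have d1 : 1 = delta_mx 0 0 + delta_mx 1 1 :> 'M[R[i]]_2.
    by rewrite -[LHS]/(1%:M) mx1_sum_delta big_ord_recl big_ord1.
  rewrite -[LHS]mulr1 -{1}(site1 R L x) -(site1 R L y) d1 !siteD // mulrDl !mulrDr.
  by rewrite addrACA.
rewrite /xyK expmx_cubic // HH HE -/(sinh R beta) /edge_op /= !big_ord_recl !big_ord0 !addr0.
rewrite /edge_coef /=.
have o1 : lift ord0 ord0 = 1 :> 'I_2 by apply: val_inj.
have k0 (c : R[i]) : \matrix_(k < 2, l < 2) ((if k == ord0 then 1 else c) *+ (k == l)) =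
    delta_mx 0 0 + c *: delta_mx 1 1.
  apply/matrixP => k l; rewrite !mxE.
  by case: (ord2P k) => ->; case: (ord2P l) => ->; rewrite /= ?mulr1n ?mulr0n ?mulr0 ?mulr1 ?addr0 ?add0r.
have k1 (c : R[i]) : \matrix_(k < 2, l < 2) ((if k == 1 then 1 else c) *+ (k == l)) =
    c *: delta_mx 0 0 + delta_mx 1 1.
  apply/matrixP => k l; rewrite !mxE.
  by case: (ord2P k) => ->; case: (ord2P l) => ->; rewrite /= ?mulr1n ?mulr0n ?mulr0 ?mulr1 ?addr0 ?add0r.
have sA c (U V : loc R L) : (c *: U) * V = c *: (U * V).
  by rewrite -[LHS]/(_ *m _) -scalemxAl.
rewrite !o1 k0 k1 !(siteD _ _ _ _ _ xL) !(siteZ _ _ _ _ _ xL) !mulrDl !sA.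
rewrite -!/(e _ _ _ _) e1 rmorphB rmorph1 /=.
move: (e 0 0 0 0) (e 1 1 0 0) (e 0 0 1 1) (e 1 1 1 1) (e 0 1 1 0) (e 1 0 0 1) => E1 E2 E3 E4 E5 E6.
by apply/matrixP => k l; rewrite !mxE; ring.
Qed.

Section Reduction.
Context {R : realType} (C S : R).
Local Notation red := (edge_red C S).

Lemma edge_red_linr a : linear (red a).
Proof.
move=> c b b'; rewrite /edge_red scalerA mulrC -scalerA -scalerDr; congr (_ *: _).
do 4!(rewrite scaler_sumr -big_split /=; apply: eq_bigr => ? _).
rewrite mulrDr mulrDl -scalerAr -scalerAl.
by rewrite ntr_linear scalerDl scalerA.
Qed.

Lemma edge_red_linl b : linear (red^~ b).
Proof.
move=> c a a'; rewrite /edge_red scalerA mulrC -scalerA -scalerDr; congr (_ *: _).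
do 4!(rewrite scaler_sumr -big_split /=; apply: eq_bigr => ? _).
rewrite mulrDr mulrDl -scalerAr -scalerAl scalerDr; congr (_ + _).
by rewrite !scalerA; congr (_ *: _); exact: mulrC.
Qed.

Lemma ntr_delta (b : 'M[R[i]]_2) i j k l :
  ntr (delta_mx i j * b * delta_mx k l) = (b j k *+ (l == i)) / 2.
Proof.
rewrite /ntr; congr (_ / _).
rewrite -[_ * _]/(_ *m _ *m _) -mulmxA mxtrace_mulC -mulmxA mul_delta_mx_cond.
case: eqP => _; last by rewrite !mulr0n mulmx0 mxtrace0.
rewrite !mulr1n /mxtrace (bigD1 j) //= mxE (bigD1 k) //= mxE !eqxx mulr1.
rewrite big1 => [|r /negPf rk]; last by rewrite mxE rk mulr0.
rewrite big1 ?addr0 // => p /negPf pj; rewrite mxE big1 // => r _.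
by rewrite mxE pj andbF mulr0.
Qed.

Lemma sum2 (V : nmodType) (F : 'I_2 -> V) : \sum_i F i = F 0 + F 1.
Proof. by rewrite big_ord_recl big_ord1; congr (_ + F _); exact: val_inj. Qed.

Definition edge_coef_entry (i j p q : 'I_2) : R[i] :=
  if i == j then (if p == q then (if p == i then 1 else C%:C) else 0)
  else if (p == j) && (q == i) then S%:C else 0.

Lemma edge_coefE i j p q : edge_coef C S i j p q = edge_coef_entry i j p q.
Proof.
rewrite /edge_coef_entry /edge_coef; case: eqP => _; rewrite !mxE; first by case: (p =P q).
by case: andb; rewrite ?mulr1 ?mulr0.
Qed.

(** A sum over the two indices that unfolds by conversion; edge_redE is stated
    with it so that all its terms are reached in one step. *)
Definition add2 (F : 'I_2 -> R[i]) : R[i] := F 0 + F 1.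

Lemma add2E F : \sum_i F i = add2 F.
Proof. exact: sum2. Qed.

(** The trace of e_ij b e_kl is 0 unless l = i, which removes one of the four
    sums. *)
Lemma edge_redE a b p q : red a b p q =
  C%:C ^- 2 / 2 * add2 (fun i => add2 (fun j => add2 (fun k => b j k *
     add2 (fun s => add2 (fun r => edge_coef_entry i j p r * a r s) * edge_coef_entry k i s q)))).
Proof.
rewrite /edge_red mxE -mulrA; congr (_ * _).
rewrite -add2E summxE mulr_sumr; apply: eq_bigr => i _.
rewrite -add2E summxE mulr_sumr; apply: eq_bigr => j _.
rewrite -add2E summxE mulr_sumr; apply: eq_bigr => k _.
rewrite (bigD1 i) //= big1 => [|l /negPf li]; last first.
  by rewrite ntr_delta li mulr0n mul0r scale0r.
rewrite ntr_delta eqxx mulr1n addr0 mxE [b j k / 2]mulrC -[LHS]mulrA; congr (_ * (_ * _)).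
rewrite mxE -add2E; apply: eq_bigr => s _; rewrite mxE -add2E edge_coefE; congr (_ * _).
by apply: eq_bigr => r _; rewrite edge_coefE.
Qed.

Definition offdiag (b : 'M[R[i]]_2) : 'M[R[i]]_2 := \matrix_(p, q) (if p == q then 0 else b p q).

Hypothesis CS : C ^+ 2 - S ^+ 2 = 1.
Hypothesis C0 : C != 0.

Lemma edge_red1l b : red 1 b = (ntr b)%:M + (S%:C / C%:C ^+ 2) *: offdiag b.
Proof.
have c0 : C%:C != 0 :> R[i] by rewrite fmorph_eq0.
have cs : C%:C ^+ 2 = 1 + S%:C ^+ 2 :> R[i].
  by rewrite -!rmorphXn /= -(rmorph1 (real_complex R)) -rmorphD -CS subrK.
rewrite /ntr /mxtrace sum2; apply/matrixP => p q; rewrite edge_redE !mxE /add2 /edge_coef_entry.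
case: (ord2P p) => ->; case: (ord2P q) => -> /=; rewrite !mxE /= ?mulr1n ?mulr0n;
move: (C%:C) (S%:C) (b 0 0) (b 0 1) (b 1 0) (b 1 1) c0 cs => c s b00 b01 b10 b11 c0 cs;
apply/subr0_eq.
(* The diagonal entries agree modulo the relation c^2 = 1 + s^2. *)
- by transitivity ((1 + s ^+ 2 - c ^+ 2) * (b00 / (2 * c ^+ 2))); [field|rewrite cs subrr mul0r].
- by field.
- by field.
- by transitivity ((1 + s ^+ 2 - c ^+ 2) * (b11 / (2 * c ^+ 2))); [field|rewrite cs subrr mul0r].
Qed.

Lemma offdiag1 : offdiag 1 = 0.
Proof. by apply/matrixP => p q; rewrite !mxE; case: (p == q). Qed.

Lemma ntr1 n : ntr (1 : 'M[R[i]]_n.+1) = 1.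
Proof. by rewrite /ntr mxtrace1 mulfV // pnatr_eq0. Qed.

Lemma edge_red11 : red 1 1 = 1.
Proof. by rewrite edge_red1l offdiag1 scaler0 addr0 ntr1. Qed.

Lemma edge_red_offdiag (o : 'M[R[i]]_2) : o 0 0 = 0 -> o 1 1 = 0 -> red o 1 = C%:C^-1 *: o.
Proof.
move=> o0 o1; have c0 : C%:C != 0 :> R[i] by rewrite fmorph_eq0.
apply/matrixP => p q; rewrite edge_redE [RHS]mxE /add2 /edge_coef_entry.
case: (ord2P p) => ->; case: (ord2P q) => -> /=; rewrite !mxE ?o0 ?o1 /=;
move: (C%:C) (S%:C) (o 0 1) (o 1 0) c0 => c s b01 b10 c0;
by field.
Qed.

Lemma edge_red_offdiag_part b : red (offdiag b) 1 = C%:C^-1 *: offdiag b.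
Proof. by apply: edge_red_offdiag; rewrite mxE. Qed.

(** The edge to the second child is the innermost one in the chain, hence it is
    contracted first. *)
Definition vertex_red (a b c : 'M[R[i]]_2) : 'M[R[i]]_2 := red (red a c) b.

Lemma vertex_redE a b c : vertex_red a b c = red (red a c) b.
Proof. by []. Qed.

Definition branch_red (i : 'I_2) (b : 'M[R[i]]_2) : 'M[R[i]]_2 :=
  if i == 0 then vertex_red 1 b 1 else vertex_red 1 1 b.

(** The decay rate of the off-diagonal part, S / C^2 for the first child and
    S / C^3 for the second one. *)
Definition branch_rate (i : 'I_2) : R := S / C ^+ (2 + i).

(** For the first child only the edge to that child acts on b. For the second
    one the result is contracted with the trivial edge to the first child, which
    divides the off-diagonal part by C once more. *)
Lemma branch_redE i b : branch_red i b = (ntr b)%:M + (branch_rate i)%:C *: offdiag b.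
Proof.
have -> : (branch_rate i)%:C = S%:C / C%:C ^+ (2 + i) :> R[i].
  by rewrite /branch_rate rmorphM fmorphV rmorphXn.
rewrite /branch_red /vertex_red.
case: (ord2P i) => -> /=; first by rewrite edge_red11 edge_red1l.
rewrite edge_red1l -scalemx1 edge_red_linl edge_red11.
rewrite -[_ *: offdiag b]addr0 edge_red_linl.
have -> : red 0 1 = 0 by have := edge_red_linl 1 (-1) 0 0; rewrite scaler0 addr0 scaleN1r addNr.
by rewrite addr0 edge_red_offdiag_part scalerA -mulrA -invfM -exprSr.
Qed.

Lemma ntr_offdiag b : ntr (offdiag b) = 0.
Proof. by rewrite /ntr /mxtrace sum2 !mxE /= addr0 mul0r. Qed.

Lemma ntr_scalar_offdiag t u b : ntr (t%:M + u *: offdiag b) = t.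
Proof.
have n1 : ntr (1%:M : 'M[R[i]]_2) = 1 by exact: ntr1.
rewrite -scalemx1 ntr_linear n1 mulr1 -[u *: _]addr0 ntr_linear.
by rewrite ntr_offdiag mulr0 raddf0 !addr0.
Qed.

Lemma offdiag_scalar_offdiag t u b : offdiag (t%:M + u *: offdiag b) = u *: offdiag b.
Proof.
by apply/matrixP => p q; rewrite !mxE; case: eqP => _; rewrite ?mulr0 // mulr0n add0r.
Qed.

Lemma iter_branch_red i n b :
  iter n.+1 (branch_red i) b = (ntr b)%:M + (branch_rate i ^+ n.+1)%:C *: offdiag b.
Proof.
elim: n => [|n IH]; first by rewrite /= branch_redE expr1.
rewrite iterS IH branch_redE ntr_scalar_offdiag offdiag_scalar_offdiag scalerA -rmorphM.
by rewrite -exprS.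
Qed.

(** |S| < C because S^2 = C^2 - 1, and C >= 1. *)
Lemma branch_rate_lt1 i : 0 < C -> `|branch_rate i| < 1.
Proof.
move=> Cp; rewrite normrM normfV ltr_pdivrMr ?normr_gt0 ?expf_neq0 // mul1r normrX (gtr0_norm Cp).
have SC : `|S| < C.
  rewrite -ltr_sqr ?nnegrE ?normr_ge0 ?ltW //.
  by rewrite real_normK ?num_real // -subr_gt0 CS.
have C1 : 1 <= C.
  have h : 1 <= C ^+ 2.
    by rewrite -[leRHS](subrK (S ^+ 2)) CS lerDl sqr_ge0.
  by rewrite expr_ge1 ?(ltW Cp) in h.
by apply: lt_le_trans SC _; rewrite -[leLHS]expr1 ler_weXn2l.
Qed.

End Reduction.

(* Keeps conversion from unfolding the sixteen-term sums. *)
#[global] Opaque edge_red vertex_red.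

(** * Contraction of the tree from its leaves *)

Lemma adjmx1 (R : realType) n : adjmx (1 : 'M[R[i]]_n) = 1.
Proof. by rewrite /adjmx trmx1 map_mx1. Qed.

Lemma commutes_at_adj (R : realType) (L : {fset vertex}) y (V : loc R L) :
  commutes_at y V -> commutes_at y (adjmx V).
Proof.
move=> h b; have := congr1 (@adjmx R _ _) (h (adjmx b)).
by rewrite !adjmx_mul !adj_site adjmxK => <-.
Qed.

Section TreeReduction.
Context {R : realType} (C S : R).
Implicit Types (m : vertex -> 'M[R[i]]_2) (x z : vertex).

Definition subtree (i : 'I_2) m : vertex -> 'M[R[i]]_2 := fun x => m (i :: x).

(** Contraction, from generation n up to the root, of the family m. The recursion
    goes down from the root so that it fits with shifts of the tree. *)
Fixpoint tree_red n m : 'M[R[i]]_2 :=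
  if n is n'.+1 then
    vertex_red C S (m [::]) (tree_red n' (subtree 0 m)) (tree_red n' (subtree 1 m))
  else m [::].

(** Contraction of the last generation n + 1 into generation n. *)
Definition contract n m : vertex -> 'M[R[i]]_2 := fun z =>
  if size z == n then vertex_red C S (m z) (m (child z 0)) (m (child z 1))
  else if size z == n.+1 then 1 else m z.

(** Contracting from the leaves agrees with the recursion from the root: this
    links the removal of a generation of edges of the chain with tree_red. *)
Lemma tree_red_contract n m : tree_red n.+1 m = tree_red n (contract n m).
Proof.
elim: n m => [|n IH] m; first reflexivity.
rewrite -[LHS]/(vertex_red C S (m [::]) (tree_red n.+1 (subtree 0 m)) (tree_red n.+1 (subtree 1 m))).
by rewrite (IH (subtree 0 m)) (IH (subtree 1 m)).
Qed.

Definition trivial_from n m := forall x, (n <= size x)%N -> m x = 1.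

Lemma trivial_from_contract n m : trivial_from n.+2 m -> trivial_from n.+1 (contract n m).
Proof.
move=> h x hx; rewrite /contract gtn_eqF //.
by case: (eqVneq (size x) n.+1) => // ne; rewrite h // ltn_neqAle eq_sym ne.
Qed.

Lemma trivial_from_subtree n m i : trivial_from n.+1 m -> trivial_from n (subtree i m).
Proof. by move=> h x hx; apply: h. Qed.

Hypothesis CS : C ^+ 2 - S ^+ 2 = 1.
Hypothesis C0 : C != 0.

Lemma vertex_red111 : vertex_red C S 1 1 1 = 1.
Proof. by rewrite vertex_redE !edge_red11. Qed.

Lemma tree_red1 n m : trivial_from 0 m -> tree_red n m = 1.
Proof.
elim: n m => [|n IH] m h /=; first exact: h.
by rewrite !IH ?h ?vertex_red111 // => x _; apply: h.
Qed.

Lemma tree_red_trivial_from l n m : trivial_from l m -> tree_red (l + n) m = tree_red l m.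
Proof.
elim: l m => [|l IH] m h; first by rewrite !tree_red1.
by rewrite addSn /= !IH //; apply: trivial_from_subtree.
Qed.

Section Ball.
Variable N : nat.
Local Notation L := (tree_ball N).
Local Notation loc := (Defs.loc R L).

Definition vertex_op x : loc := edge_op C S L x (child x 0) * edge_op C S L x (child x 1).

(** The effect on a tensor of removing the two edges below x. *)
Definition contract_at x m : vertex -> 'M[R[i]]_2 := fun z =>
  if z == x then vertex_red C S (m x) (m (child x 0)) (m (child x 1))
  else if (z == child x 0) || (z == child x 1) then 1 else m z.

Lemma size_child x i : size (child x i) = (size x).+1.
Proof. exact: size_rcons. Qed.

Lemma child_neq x i : child x i != x.
Proof. by apply/eqP => /(congr1 size); rewrite size_child => /esym /n_Sn. Qed.

Lemma child_inj x y i j : (child x i == child y j) = (x == y) && (i == j).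
Proof. exact: eqseq_rcons. Qed.

Lemma vertex_trace x (V : loc) m : (size x < N)%N ->
  commutes_at (child x 0) V -> commutes_at (child x 1) V ->
  ntr (adjmx (vertex_op x) * V * vertex_op x * tensor L m) =
  C%:C ^+ 4 * ntr (V * tensor L (contract_at x m)).
Proof.
move=> xN c0 c1.
have xL : x \in L by rewrite mem_tree_ball ltnW.
have cL i : child x i \in L by rewrite mem_tree_ball size_child.
have xc i : x != child x i by rewrite eq_sym child_neq.
have c01 : child x 0 != child x 1 by rewrite child_inj eqxx.
rewrite /vertex_op adjmx_mul !adj_edge_op //.
set K0 := edge_op _ _ _ _ (child x 0); set K1 := edge_op _ _ _ _ (child x 1).
have -> : K1 * K0 * V * (K0 * K1) = K1 * (K0 * V * K0) * K1 by rewrite !mulrA.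
rewrite edge_trace //; last first.
  by do 2?apply: commutes_atM => //; apply: commutes_at_edge_op; rewrite ?child_neq // eq_sym.
rewrite edge_trace // mulrA -exprD; congr (_ * ntr (_ * _)).
apply: eq_tensor => z _ /=; rewrite /contract_at vertex_redE.
case: (eqVneq z x) => [_|zx].
  by rewrite eqxx !ifN ?child_neq // child_inj andbF.
by case: (z == child x 0).
Qed.

Lemma commutes_at_vertex_op x z : z != x -> (forall i, z != child x i) ->
  commutes_at z (vertex_op x).
Proof. by move=> zx zc; apply: commutes_atM; apply: commutes_at_edge_op. Qed.

Definition contract_seq s m := foldr contract_at m s.

(** The vertices of one generation are handled one after the other: conjugating V
    by the operator of one vertex keeps it supported off the children of the
    others. *)
Lemma level_trace n (s : seq vertex) (V : loc) m : (n < N)%N -> uniq s ->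
  {in s, forall x, size x = n} ->
  {in s, forall x, forall i, commutes_at (child x i) V} ->
  ntr (adjmx (\prod_(x <- s) vertex_op x) * V * (\prod_(x <- s) vertex_op x) * tensor L m) =
  (C%:C ^+ 4) ^+ size s * ntr (V * tensor L (contract_seq s m)).
Proof.
move=> nN; elim: s V m => [|x s IH] V m /=.
  by rewrite !big_nil expr0 mul1r mulr1 adjmx1 mul1r.
move=> /andP[xs us] hs hV; rewrite !big_cons adjmx_mul.
set P := \prod_(j <- s) _.
have sx : size x = n by apply: hs; rewrite inE eqxx.
have ss : {in s, forall y, size y = n} by move=> y ys; apply: hs; rewrite inE ys orbT.
have -> : adjmx P * adjmx (vertex_op x) * V * (vertex_op x * P) =
  adjmx P * (adjmx (vertex_op x) * V * vertex_op x) * P by rewrite !mulrA.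
rewrite IH //.
  rewrite vertex_trace ?sx //; last 2 first.
  - by apply: hV; rewrite inE eqxx.
  - by apply: hV; rewrite inE eqxx.
  by rewrite [_ ^+ (size s).+1]exprSr mulrA.
move=> y ys i.
have c : commutes_at (child y i) (vertex_op x).
  apply: commutes_at_vertex_op => [|j].
    by apply/eqP => /(congr1 size); rewrite size_child sx (ss _ ys) => /esym /n_Sn.
  by rewrite child_inj negb_and (memPn xs).
apply: commutes_atM => //; apply: commutes_atM; first exact: commutes_at_adj.
by apply: hV; rewrite inE ys orbT.
Qed.

Lemma contract_seqE n s m z : uniq s -> {in s, forall x, size x = n} ->
  contract_seq s m z =
  if z \in s then vertex_red C S (m z) (m (child z 0)) (m (child z 1))
  else if has (fun x => (z == child x 0) || (z == child x 1)) s then 1 else m z.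
Proof.
move=> + hs; elim: s hs z => [//|x s IH] hs z /= /andP[xs us].
have sx : size x = n by apply: hs; rewrite inE eqxx.
have ss : {in s, forall y, size y = n} by move=> y ys; apply: hs; rewrite inE ys orbT.
have cs y i : size y = n -> child y i \notin x :: s.
  move=> sy; apply/negP => /hs /eqP; rewrite size_child sy => /eqP /esym.
  exact: n_Sn.
have nh y : size y = n -> has (fun x => (y == child x 0) || (y == child x 1)) s = false.
  move=> sy; apply/negbTE/hasPn => y' y's.
  by apply/negP => /orP[] /eqP /(congr1 size); rewrite size_child sy (ss _ y's) => /n_Sn.
have hc i : has (fun y => (child x i == child y 0) || (child x i == child y 1)) s = false.
  apply/negbTE/hasPn => y ys.
  by rewrite !child_inj [x == y]eq_sym (negPf (memPn xs y ys)).
have cs' i : child x i \in s = false.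
  by have := cs x i sx; rewrite inE negb_or => /andP[_ /negbTE].
rewrite /contract_at inE !IH //; case: (eqVneq z x) => [->|zx] /=.
  by rewrite (negPf xs) (nh _ sx) !cs' !hc.
case: ifP => //= /orP h.
have zs : z \in s = false.
  by case: h => /eqP ->; rewrite cs'.
by rewrite zs.
Qed.

Lemma contract_sphere n m : contract_seq (tree_sphere n) m = contract n m.
Proof.
apply/funext => z; rewrite (@contract_seqE n) ?uniq_tree_sphere //; last first.
  by move=> x; rewrite mem_tree_sphere => /eqP.
rewrite /contract mem_tree_sphere; case: eqP => // _; congr (if _ then _ else _).
apply/hasP/eqP => [[x]|].
  by rewrite mem_tree_sphere => /eqP <- /orP[] /eqP ->; rewrite size_child.
case/lastP: z => // z i; rewrite size_rcons => -[sz]; exists z.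
  by rewrite mem_tree_sphere sz.
by rewrite !child_inj eqxx /=; case: (ord2P i) => ->.
Qed.

Definition chain_prod n : loc := \prod_(k < n) \prod_(x <- tree_sphere k) vertex_op x.

Lemma commutes_at_chain_prod n z : (n < size z)%N -> commutes_at z (chain_prod n).
Proof.
move=> nz; apply: commutes_at_prod => k _; apply: commutes_at_prod => x.
rewrite mem_tree_sphere => /eqP sx; apply: commutes_at_vertex_op => [|i].
  apply/eqP => zx; move: nz (ltn_ord k); rewrite zx sx => h /(ltn_trans h).
  by rewrite ltnn.
apply/eqP => zx; move: nz (ltn_ord k); rewrite zx size_child sx => h /(leq_trans h).
by rewrite ltnn.
Qed.

(** The operators of the first n generations live on the ball of radius n, so the
    children of generation n can be traced out; then induct. *)
Lemma chain_prod_trace n : (n <= N)%N -> exists c : R[i], forall m, trivial_from n.+1 m ->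
  ntr (adjmx (chain_prod n) * chain_prod n * tensor L m) = c * ntr (tree_red n m).
Proof.
elim: n => [_|n IH nN].
  exists (ntr (1 : loc)) => m hm; rewrite /chain_prod big_ord0 adjmx1 mulr1 mul1r.
  rewrite (_ : tensor L m = 1 * site L [::] (m [::])); last first.
    rewrite mul1r; apply: eq_tensor => z _; case: eqP => [->//|/eqP zn].
    by rewrite hm // lt0n size_eq0.
  have rL : [::] \in L by rewrite mem_tree_ball.
  rewrite (ntr_site _ _ _ _ _ rL (commutes_at1 _ _ _)).
  by rewrite mulrC.
have [c hc] := IH (ltnW nN).
exists ((C%:C ^+ 4) ^+ size (tree_sphere n) * c) => m hm.
rewrite /chain_prod big_ord_recr /= -/(chain_prod n) adjmx_mul.
set P := \prod_(x <- _) _.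
rewrite (_ : adjmx P * _ * _ = adjmx P * (adjmx (chain_prod n) * chain_prod n) * P); last first.
  by rewrite !mulrA.
rewrite (level_trace n) ?uniq_tree_sphere //.
- rewrite contract_sphere hc; last exact: trivial_from_contract.
  by rewrite -tree_red_contract mulrA.
- by move=> x; rewrite mem_tree_sphere => /eqP.
move=> x; rewrite mem_tree_sphere => /eqP sx i.
have h : commutes_at (child x i) (chain_prod n).
  by apply: commutes_at_chain_prod; rewrite size_child sx.
by apply: commutes_atM => //; exact: commutes_at_adj.
Qed.

End Ball.
End TreeReduction.

(** * The density of the chain *)

Lemma cosh_gt0 (R : realType) (t : R) : 0 < cosh t.
Proof. by rewrite /cosh divr_gt0 // addr_gt0 // expR_gt0. Qed.

Lemma cosh2B_sinh2 (R : realType) (t : R) : cosh t ^+ 2 - sinh R t ^+ 2 = 1.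
Proof.
have h : expR t * expR (- t) = 1 by rewrite -expRD subrr expR0.
by rewrite /cosh /sinh -[RHS]h; field.
Qed.

Lemma site_scalar (R : realType) (L : {fset vertex}) x (c : R[i]) : x \in L ->
  site L x c%:M = c%:M.
Proof. by move=> xL; rewrite -scalemx1 siteZ // (site1 R L x) -[1]/(1%:M) scalemx1. Qed.

Section ChainOp.
Context {R : realType} (beta : R).
Local Notation C := (cosh beta).
Local Notation S := (sinh R beta).

(** The square roots of w_0 and of the h_x are scalar and factor out. *)
Lemma chain_op_scalar n : exists c : R[i],
  chain_op (C ^+ 4)%:C%:M (fun=> (C ^- 4)%:C%:M) (xyK beta) n =
  c *: chain_prod C S n n.
Proof.
have Cp := @cosh_gt0 R beta.
rewrite /chain_op !sqrtmx_scalar ?invr_gt0 ?exprn_gt0 //.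
rewrite site_scalar ?mem_tree_ball //.
have [d ->] : exists d : R[i], \prod_(x <- tree_sphere n)
    site (tree_ball n) x (Num.sqrt (C ^- 4))%:C%:M = d%:M.
  rewrite big_seq; elim/big_ind: _ => [|a b [c ->] [d ->]|x].
  - by exists 1.
  - by exists (c * d); rewrite scalar_mxM.
  rewrite mem_tree_sphere => /eqP sx; exists (Num.sqrt (C ^- 4))%:C.
  by rewrite site_scalar // mem_tree_ball sx.
set P := \prod_(m < n) _.
have -> : P = chain_prod C S n n.
  apply: eq_bigr => k _; rewrite !big_seq; apply: eq_bigr => x.
  rewrite mem_tree_sphere => /eqP sx.
  have xc i : x != child x i by rewrite eq_sym child_neq.
  have sub i : [fset x; child x i] `<=` tree_ball n.
    apply/fsubsetP => y; rewrite in_fset2 mem_tree_ball => /orP[] /eqP ->.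
      by rewrite sx ltnW.
    by rewrite size_child sx.
  by rewrite /vertex_op !xyK_edge_op // !loc_extend_edge_op // in_fset2 eqxx ?orbT.
exists (d * (Num.sqrt (C ^+ 4))%:C).
by rewrite -[LHS]/(_ *m _ *m _) mul_scalar_mx mul_mx_scalar scalerA.
Qed.

End ChainOp.

(** * Shifts and contractions *)

Section Shift.
Context {R : realType}.
Implicit Types m : vertex -> 'M[R[i]]_2.

(** The family m moved to the subtree at the i-th child of the root, 1 elsewhere. *)
Definition shift_family (i : 'I_2) m : vertex -> 'M[R[i]]_2 := fun z =>
  if z is j :: x then (if j == i then m x else 1) else 1.

Lemma trivial_from_shift_family i n m : trivial_from n m -> trivial_from n.+1 (shift_family i m).
Proof. by move=> h [|j x] //= hx; case: ifP => // _; apply: h. Qed.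

Lemma trivial_from_iter_shift_family i k n m : trivial_from n m -> trivial_from (k + n) (iter k (shift_family i) m).
Proof. by move=> h; elim: k => [|k IH] //; exact: trivial_from_shift_family. Qed.

Lemma trivial_fromW n n' m : (n <= n')%N -> trivial_from n m -> trivial_from n' m.
Proof. by move=> nn h x hx; apply: h; exact: leq_trans hx. Qed.

Lemma subtree_shift_family i j m : subtree j (shift_family i m) = if j == i then m else fun=> 1.
Proof. by apply/funext => x; rewrite /subtree /=; case: eqP. Qed.

Lemma shift_family1 i : shift_family i (fun=> 1) = fun=> 1 :> 'M[R[i]]_2.
Proof. by apply/funext => -[|j x] //=; case: ifP. Qed.

Lemma iter_shift_family1 i k : iter k (shift_family i) (fun=> 1) = fun=> 1 :> 'M[R[i]]_2.
Proof. by elim: k => //= k ->; exact: shift_family1. Qed.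

Context (C S : R) (CS : C ^+ 2 - S ^+ 2 = 1) (C0 : C != 0).

Lemma tree_red_shift_family i n m :
  tree_red C S n.+1 (shift_family i m) = branch_red C S i (tree_red C S n m).
Proof.
rewrite /= !subtree_shift_family /branch_red.
by case: (ord2P i) => ->; rewrite /= (tree_red1 C S CS C0 n (fun=> 1)).
Qed.

Lemma tree_red_iter_shift_family i k n m :
  tree_red C S (k + n) (iter k (shift_family i) m) = iter k (branch_red C S i) (tree_red C S n m).
Proof. by elim: k => //= k IH; rewrite -IH -tree_red_shift_family. Qed.

(** A tensor shifted l times down the branch i, times a tensor m' on the first l
    generations: the contraction of the shifted tensor enters at one vertex of the
    l-th generation only, and the vertex maps are linear in each slot. *)
Lemma tree_red_below i l m' : trivial_from l m' ->
  exists2 G : 'M[R[i]]_2 -> 'M[R[i]]_2, linear G &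
    forall N m, tree_red C S (l + N) (fun x => iter l (shift_family i) m x * m' x) =
                G (tree_red C S N m).
Proof.
elim: l m' => [|l IH] m' h.
  exists id => // N m; congr (tree_red _ _ _ _).
  by apply/funext => x; rewrite h // mulr1.
have step m j : subtree j (fun x => iter l.+1 (shift_family i) m x * m' x) =
    if j == i then (fun x => iter l (shift_family i) m x * subtree j m' x) else subtree j m'.
  apply/funext => x; rewrite /subtree /=; case: eqP => // _; exact: mul1r.
have E N m : tree_red C S (l.+1 + N) (fun x => iter l.+1 (shift_family i) m x * m' x) =
    vertex_red C S (m' [::])
      (tree_red C S (l + N) (subtree 0 (fun x => iter l.+1 (shift_family i) m x * m' x)))
      (tree_red C S (l + N) (subtree 1 (fun x => iter l.+1 (shift_family i) m x * m' x))).
  rewrite -[in RHS](mul1r (m' [::])); reflexivity.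
have hs j : trivial_from l (subtree j m') by exact: trivial_from_subtree.
have stab N j : tree_red C S (l + N) (subtree j m') = tree_red C S l (subtree j m').
  exact: tree_red_trivial_from.
have [G Glin GE] := IH _ (hs i).
have e10 : (1 == 0 :> 'I_2) = false by [].
have e01 : (0 == 1 :> 'I_2) = false by [].
case: (ord2P i) => ei; subst i.
  (* The branch i passes through the first child of the root, or through the
     second one. *)
  exists (fun b => vertex_red C S (m' [::]) (G b) (tree_red C S l (subtree 1 m'))).
    by move=> c a b; rewrite !vertex_redE Glin edge_red_linr.
  by move=> N m; rewrite E !step eqxx e10 GE stab.
exists (fun b => vertex_red C S (m' [::]) (tree_red C S l (subtree 0 m')) (G b)).
  by move=> c a b; rewrite !vertex_redE Glin edge_red_linr edge_red_linl.
by move=> N m; rewrite E !step eqxx e01 GE stab.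
Qed.

End Shift.

(** * Convergence from a dense subset *)

Section DenseConvergence.
Context {R : realType} {A : cstarAlgType R}.

(** Uniformly bounded additive maps converge pointwise as soon as they do on a
    dense set. *)
Lemma dense_cvg (F : nat -> A -> R[i]) (G : A -> R[i]) (M M' : R) (a : A) :
  0 < M -> 0 < M' ->
  (forall n x y, F n (x - y) = F n x - F n y) ->
  (forall x y, G (x - y) = G x - G y) ->
  (forall n x s, 0 < s -> cnorm x <= s -> `|F n x| <= (M * s)%:C) ->
  (forall x s, 0 < s -> cnorm x <= s -> `|G x| <= (M' * s)%:C) ->
  (forall e : R, 0 < e -> exists2 a' : A, cnorm (a - a') < e &
      (fun n => F n a' : R[i]^o) @ \oo --> (G a' : R[i]^o)) ->
  (fun n => F n a : R[i]^o) @ \oo --> (G a : R[i]^o).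
Proof.
move=> M0 M'0 FB GB Fb Gb dense; apply/cvgrPdist_lt => e /posc_real [r r0 ->].
pose s := r / (3 * (M + M')).
have s0 : 0 < s by rewrite divr_gt0 // mulr_gt0 // addr_gt0.
have Ms : M * s + M' * s = r / 3 by rewrite /s; field; lra.
have [a' aa' /cvgrPdist_lt h] := dense s s0.
have r2 : 0 < (r / 2)%:C :> R[i] by rewrite ltcR divr_gt0.
have := h _ r2; apply: filterS => n hn.
have -> : G a - F n a = (G (a - a') - F n (a - a')) + (G a' - F n a').
  by rewrite GB FB; ring.
apply: le_lt_trans (ler_normD _ _) _.
have -> : r%:C = (r / 2)%:C + (r / 2)%:C :> R[i] by rewrite -rmorphD; congr (_%:C); lra.
apply: ltrD hn; apply: le_lt_trans (ler_normB _ _) _.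
apply: le_lt_trans (lerD (Gb _ _ s0 (ltW aa')) (Fb n _ _ s0 (ltW aa'))) _.
by rewrite -rmorphD ltcR addrC Ms; lra.
Qed.

End DenseConvergence.

Section StateBound.
Context {R : realType} {A : cstarAlgType R} (phi : A -> R[i]) (hphi : is_state phi).

Lemma state_comp (g : A -> A) : linear g -> monoid_morphism g ->
  (forall a, g (star a) = star (g a)) -> is_state (phi \o g).
Proof.
move=> gl [g1 gM] gs; split => [c a b|a|] /=.
- by rewrite gl (state_linear hphi).
- by rewrite gM gs; exact: state_pos.
- by rewrite g1 (state_1 hphi).
Qed.

(** Scale x and y to norm at most 1/2, and apply polarization; phi o g is a state,
    so no bound on g itself is used. *)
Lemma state_bound (g : A -> A) x y s t : linear g -> monoid_morphism g ->
  (forall a, g (star a) = star (g a)) ->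
  0 < s -> 0 < t -> cnorm x <= s -> cnorm y <= t ->
  `|phi (g x * y)| <= (8 * s * t)%:C.
Proof.
move=> gl gm gs s0 t0 xs yt; have [g1 gM] := gm.
have hg := state_comp g gl gm gs.
have g0 : g 0 = 0 by have := gl (-1) 0 0; rewrite scaler0 addr0 scaleN1r addNr.
have gZ c a : g (c *: a) = c *: g a by have := gl c a 0; rewrite g0 !addr0.
have sc (z : A) u : 0 < u -> cnorm z <= u -> exists2 z' : A, cnorm z' <= 1 / 2 & z = (2 * u)%:C *: z'.
  move=> u0 zu; exists ((2 * u)^-1%:C *: z).
    rewrite cnormZR ger0_norm ?invr_ge0 ?mulr_ge0 ?(ltW u0) //.
    by rewrite mulrC ler_pdivrMr ?mulr_gt0 //; lra.
  by rewrite scalerA -rmorphM mulfV ?scale1r // mulf_neq0 ?gt_eqF.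
have [x' x1 ->] := sc x s s0 xs; have [y' y1 ->] := sc y t t0 yt.
have -> : (8 * s * t)%:C = (2 * s)%:C * (2 * t)%:C * 2 :> R[i].
  have -> : 8 * s * t = 2 * s * (2 * t) * 2 by ring.
  by rewrite rmorphM rmorphM rmorph_nat.
rewrite gZ -scalerAl -scalerAr !(stateZ phi hphi) mulrA !normrM !normc_real.
have s2 : 0 <= 2 * s by lra.
have t2 : 0 <= 2 * t by lra.
rewrite (ger0_norm s2) (ger0_norm t2); apply: ler_wpM2l.
  by rewrite mulr_ge0 // lecR.
have -> : g x' = star (g (star x')) by rewrite gs starK.
apply: le_trans (state_polarization phi hphi _ _) _.
rewrite -[leRHS]/(1 + 1 : R[i]); apply: lerD; first exact: state_star_le1.
rewrite -gs -gM; apply: (state_star_le1 (phi \o g) hg).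
by rewrite cnorm_starE.
Qed.

End StateBound.

(** * The chain on the inductive limit *)

Section Limit.
Context {R : realType} {A : cstarAlgType R}
  (inj : forall L : {fset vertex}, loc R L -> A) (hA : is_inductive_limit inj).
Implicit Types m : vertex -> 'M[R[i]]_2.

(** The image in A of an elementary tensor on the ball of radius n. *)
Definition local_tensor n m : A := inj (tree_ball n) (tensor (tree_ball n) m).

Lemma inj1 L : inj L 1 = 1.
Proof. exact: (inj_mult hA L).1. Qed.

Lemma injM L a b : inj L (a * b) = inj L a * inj L b.
Proof. exact: (inj_mult hA L).2. Qed.

Lemma inj0 L : inj L 0 = 0.
Proof. by have := @inj_linear _ _ _ hA L (-1) 0 0; rewrite scaler0 addr0 scaleN1r addNr. Qed.

Lemma local_tensor1 n : local_tensor n (fun=> 1) = 1.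
Proof. by rewrite /local_tensor -[fun=> 1]/(fun=> 1%:M) tensor1 inj1. Qed.

Lemma local_tensorM n m m' : local_tensor n m * local_tensor n m' = local_tensor n (fun x => m x * m' x).
Proof. by rewrite /local_tensor -injM tensorM. Qed.

Lemma local_tensor_widen n n' m : (n <= n')%N -> trivial_from n.+1 m -> local_tensor n' m = local_tensor n m.
Proof.
move=> nn h; rewrite /local_tensor -(loc_extend_tensor R (tree_ball n)).
- by rewrite (inj_compatible hA) // tree_ball_sub.
- exact: tree_ball_sub.
by move=> y; rewrite mem_tree_ball -ltnNge => /h.
Qed.

Lemma inj_site (L : {fset vertex}) x (a : 'M[R[i]]_2) : x \in L ->
  inj L (site L x a) = inj [fset x] (site [fset x] x a).
Proof.
move=> xL; have s : [fset x] `<=` L by rewrite fsub1set.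
by rewrite -(inj_compatible hA (site [fset x] x a) s) loc_extend_site // in_fset1.
Qed.

(** The shift is given on single sites only; a tensor is the product of its
    sites. *)
Lemma shift_local_tensor i (g : A -> A) n m : is_shift inj i g -> trivial_from n.+1 m ->
  g (local_tensor n m) = local_tensor n.+1 (shift_family i m).
Proof.
move=> hg hm; have [g1 gM] := shift_mult hg.
have iM : {morph inj (tree_ball n) : a b / a * b} by exact: injM.
have iM' : {morph inj (tree_ball n.+1) : a b / a * b} by exact: injM.
rewrite /local_tensor tensor_prod_site (big_morph _ iM (inj1 _)) (big_morph g gM g1).
pose s := [seq i :: x | x <- tree_ball n].
have us : uniq s by rewrite map_inj_uniq ?fset_uniq // => x y [].
rewrite (_ : tensor (tree_ball n.+1) (shift_family i m) =
             \prod_(z <- s) site (tree_ball n.+1) z (shift_family i m z)); last first.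
  rewrite prod_site //; apply: eq_tensor => z _; case: ifPn => //.
  case: z => [|j x] //= hx; case: eqP => // ji; apply: hm.
  rewrite ltnNge -mem_tree_ball; apply: contra hx => xn.
  by rewrite ji; apply: map_f.
rewrite (big_morph _ iM' (inj1 _)) big_map !big_seq; apply: eq_bigr => x xn.
rewrite inj_site // (shift_site hg) inj_site /= ?eqxx //.
by move: xn; rewrite !mem_tree_ball.
Qed.

Lemma iter_shift_local_tensor i (g : A -> A) k n m : is_shift inj i g -> trivial_from n.+1 m ->
  iter k g (local_tensor n m) = local_tensor (k + n) (iter k (shift_family i) m).
Proof.
move=> hg hm; elim: k => [|k IH] //; rewrite iterS IH (shift_local_tensor i) //.
by rewrite -addnS; exact: trivial_from_iter_shift_family.
Qed.

Lemma local_tensor_ind (P : A -> Prop) :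
  P 0 -> (forall c a b, P a -> P b -> P (c *: a + b)) ->
  (forall n m, trivial_from n.+1 m -> P (local_tensor n m)) ->
  forall n a, P (inj (tree_ball n) a).
Proof.
move=> P0 PD Pe n; apply: loc_ind => [|c a b Pa Pb|m hm].
- by rewrite inj0.
- by rewrite (inj_linear hA); exact: PD.
by apply: Pe => x hx; apply: hm; rewrite mem_tree_ball -ltnNge.
Qed.

Lemma ball_dense (a : A) (e : R) : 0 < e ->
  exists n (b : loc R (tree_ball n)), cnorm (a - inj (tree_ball n) b) < e.
Proof.
move=> e0; have [L [b hb]] := inj_dense hA a e0.
exists (\max_(x <- L) size x)%N.
have sL : L `<=` tree_ball (\max_(x <- L) size x)%N.
  by apply/fsubsetP => x xL; rewrite mem_tree_ball; exact: leq_bigmax_seq.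
by exists (loc_extend _ b); rewrite (inj_compatible hA).
Qed.

Context (beta : R) (phi : A -> R[i])
  (hphi : is_markov_chain inj ((cosh beta ^+ 4)%:C%:M)
            (fun=> (cosh beta ^- 4)%:C%:M) (xyK beta) phi).
Local Notation C := (cosh beta).
Local Notation S := (sinh R beta).

Let CS : C ^+ 2 - S ^+ 2 = 1 := cosh2B_sinh2 R beta.
Let C0 : C != 0 := lt0r_neq0 (cosh_gt0 R beta).
Let hst := chain_state hphi.

(** The chain is proportional to the contraction, and both are 1 at the unit. *)
Lemma phi_local_tensor n m : trivial_from n.+1 m ->
  phi (local_tensor n m) = ntr (tree_red C S n.+1 m).
Proof.
have [c hc] := chain_op_scalar beta n.+1.
have [d hd] := chain_prod_trace C S C0 n.+1 n.+1 (leqnn _).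
have key m' : trivial_from n.+1 m' -> phi (local_tensor n m') = (@Num.conj R[i] c * c * d) * ntr (tree_red C S n.+1 m').
  move=> hm'; rewrite /local_tensor (chain_local hphi) /chain_density hc.
  rewrite (loc_extend_tensor R) ?tree_ball_sub //; last first.
    by move=> y; rewrite mem_tree_ball -ltnNge => /hm'.
  have -> : adjmx (c *: chain_prod C S n.+1 n.+1) = @Num.conj R[i] c *: adjmx (chain_prod C S n.+1 n.+1).
    by apply/matrixP => p q; rewrite !mxE rmorphM.
  rewrite -[_ * _ * _]/(_ *m _ *m _) -scalemxAl -scalemxAr -!scalemxAl scalerA.
  have nZ := ntr_linear R _ (@Num.conj R[i] c * c) (adjmx (chain_prod C S n.+1 n.+1) *m chain_prod C S n.+1 n.+1 *m tensor (tree_ball n.+1) m') 0.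
  rewrite !addr0 in nZ; rewrite nZ raddf0 addr0 -mulrA; congr (_ * _).
  by apply: hd; exact: trivial_fromW hm'.
have k1 : @Num.conj R[i] c * c * d = 1.
  have h1 : trivial_from n.+1 (fun=> 1 : 'M[R[i]]_2) by [].
  have := key _ h1; rewrite local_tensor1 (state_1 hst) (tree_red1 C S CS C0) // ntr1 mulr1.
  by move=> <-.
by move=> hm; rewrite key // k1 mul1r.
Qed.

Context (i : 'I_2) (g : A -> A) (hg : is_shift inj i g).

Lemma phi_shift_local_tensor n m : trivial_from n.+1 m -> phi (g (local_tensor n m)) = phi (local_tensor n m).
Proof.
move=> hm; have hm' := trivial_from_shift_family i _ _ hm.
rewrite (shift_local_tensor i g n m hg hm) (phi_local_tensor _ _ hm') (phi_local_tensor _ _ hm).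
by rewrite (tree_red_shift_family C S CS C0) (branch_redE C S CS C0) ntr_scalar_offdiag.
Qed.

Lemma iter_linear k : linear (iter k g).
Proof.
elim: k => [|k IH] c a b; first by [].
by rewrite !iterS IH (shift_linear hg).
Qed.

Lemma iter_mult k : monoid_morphism (iter k g).
Proof.
have [g1 gM] := shift_mult hg.
elim: k => [|k [IH1 IHM]] //; split => [|a b]; first by rewrite iterS IH1.
by rewrite !iterS IHM gM.
Qed.

Lemma iter_star k a : iter k g (star a) = star (iter k g a).
Proof. by elim: k => //= k ->; rewrite (shift_star hg). Qed.

(** The value at l + j + 1 shifts is tr(B) tr(G 1) plus a term proportional to the
    (j + 1)-st power of the rate, where B and G are the contraction of m and the
    linear map attached to m'. *)
Lemma clusters_local_tensor n m n' m' : trivial_from n.+1 m -> trivial_from n'.+1 m' ->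
  (fun k => phi (iter k g (local_tensor n m) * local_tensor n' m') : R[i]^o) @ \oo -->
  (phi (local_tensor n m) * phi (local_tensor n' m') : R[i]^o).
Proof.
move=> hm hm'; set l := n'.+1; move EB: (tree_red C S n.+1 m) => B.
have [G Glin GE] := tree_red_below C S CS C0 i l m' hm'.
have hG1 : phi (local_tensor n' m') = ntr (G 1).
  have E : (fun x => iter l (shift_family i) (fun=> 1) x * m' x) = m'.
    by apply/funext => x; rewrite iter_shift_family1 mul1r.
  have := GE 0%N (fun=> 1); rewrite E addn0 => GE0.
  by rewrite (phi_local_tensor _ _ hm') GE0.
have GZ (c : R[i]) (a : 'M[R[i]]_2) : G (c *: a) = c *: G a.
  have G0 : G 0 = 0 by have := Glin (-1) 0 0; rewrite scaler0 addr0 scaleN1r addNr.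
  by have := Glin c a 0; rewrite G0 !addr0.
have GD (a b : 'M[R[i]]_2) : G (a + b) = G a + G b by have := Glin 1 a b; rewrite !scale1r.
have nD (a b : 'M[R[i]]_2) : ntr (a + b) = ntr a + ntr b :> R[i].
  by have := ntr_linear R 2 1 a b; rewrite scale1r mul1r.
have nZ (c : R[i]) (a : 'M[R[i]]_2) : ntr (c *: a) = c * ntr a :> R[i].
  by have := ntr_linear R 2 c a 0; rewrite addr0 raddf0 addr0.
have value j : phi (iter (l + j.+1)%N g (local_tensor n m) * local_tensor n' m') =
    phi (local_tensor n m) * phi (local_tensor n' m') + (branch_rate C S i ^+ j.+1)%:C * ntr (G (offdiag B)).
  set K := (l + j.+1)%N.
  have lK : (l <= (K + n).+1)%N by rewrite /K -addnA -addnS leq_addr.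
  have nK : (n' <= K + n)%N by exact: lK.
  have hP : trivial_from (K + n).+1 (fun x => iter K (shift_family i) m x * m' x).
    move=> x hx; rewrite (trivial_fromW _ _ _ lK hm' x hx) mulr1.
    by apply: (trivial_from_iter_shift_family i K n.+1 m hm); rewrite addnS.
  rewrite (iter_shift_local_tensor i g K n m hg hm) -(local_tensor_widen n' (K + n) m' nK hm').
  rewrite local_tensorM (phi_local_tensor _ _ hP).
  have -> : (K + n).+1 = (l + (j.+1 + n.+1))%N by rewrite /K -addnS -addnA.
  rewrite /K iterD GE (tree_red_iter_shift_family C S CS C0) (iter_branch_red C S CS C0) EB.
  by rewrite GD -scalemx1 !GZ nD !nZ (local_tensor_widen n' (K + n) m' nK hm') -hG1 (phi_local_tensor _ _ hm) EB.
rewrite -(cvg_shiftn l.+1) /=.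
have e k : phi (iter (k + l.+1)%N g (local_tensor n m) * local_tensor n' m') =
  phi (local_tensor n m) * phi (local_tensor n' m') + (branch_rate C S i ^+ k.+1)%:C * ntr (G (offdiag B)).
  by rewrite -value addnS -addSn addnC.
rewrite (eq_cvg _ _ e).
set u := phi _ * phi _; set w := ntr _.
suff lim : (fun k => u + (branch_rate C S i ^+ k.+1)%:C * w : R[i]^o) @ \oo -->
    (u + 0%:C * w : R[i]^o) by rewrite mul0r addr0 in lim.
apply: (@cvgD _ R[i]^o); first exact: cvg_cst.
suff lim : (fun k => branch_rate C S i ^+ k.+1) @ \oo --> (0 : R).
  apply: (@cvgZr_tmp _ _ _ _ _ _ _ (w : R[i]^o)).
  exact: (cvg_real_complex R (fun k => branch_rate C S i ^+ k.+1) 0 lim).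
rewrite (cvg_shiftS (fun k => branch_rate C S i ^+ k)); apply: cvg_expr.
by apply: branch_rate_lt1 => //; exact: cosh_gt0.
Qed.

Definition clusters (x y : A) : Prop :=
  (fun k => phi (iter k g x * y) : R[i]^o) @ \oo --> (phi x * phi y : R[i]^o).

Lemma cvg_lin (u v : nat -> R[i]) (l l' c : R[i]) :
  (fun k => u k : R[i]^o) @ \oo --> (l : R[i]^o) ->
  (fun k => v k : R[i]^o) @ \oo --> (l' : R[i]^o) ->
  (fun k => c * u k + v k : R[i]^o) @ \oo --> (c * l + l' : R[i]^o).
Proof.
move=> ul vl; apply: (@cvgD _ R[i]^o); last exact: vl.
exact: (@cvgZl_tmp _ _ _ _ _ _ _ _ ul).
Qed.

Lemma iter0 k : iter k g 0 = 0.
Proof. by have := iter_linear k (-1) 0 0; rewrite scaler0 addr0 scaleN1r addNr. Qed.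

Lemma clusters0l y : clusters 0 y.
Proof.
rewrite /clusters (state0 phi hst) mul0r (_ : (fun k => _) = fun=> 0); first exact: cvg_cst.
by apply/funext => k; rewrite iter0 mul0r (state0 phi hst).
Qed.

Lemma clusters0r x : clusters x 0.
Proof.
rewrite /clusters (state0 phi hst) mulr0 (_ : (fun k => _) = fun=> 0); first exact: cvg_cst.
by apply/funext => k; rewrite mulr0 (state0 phi hst).
Qed.

Lemma clustersDl c x x' y : clusters x y -> clusters x' y -> clusters (c *: x + x') y.
Proof.
move=> h h'; rewrite /clusters (state_linear hst) mulrDl -mulrA.
rewrite (_ : (fun k => _) = fun k => c * phi (iter k g x * y) + phi (iter k g x' * y)).
  exact: (cvg_lin _ _ _ _ c h h').
by apply/funext => k; rewrite iter_linear mulrDl -scalerAl (state_linear hst).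
Qed.

Lemma clustersDr c x y y' : clusters x y -> clusters x y' -> clusters x (c *: y + y').
Proof.
move=> h h'; rewrite /clusters (state_linear hst) mulrDr mulrCA.
rewrite (_ : (fun k => _) = fun k => c * phi (iter k g x * y) + phi (iter k g x * y')).
  exact: (cvg_lin _ _ _ _ c h h').
by apply/funext => k; rewrite mulrDr -scalerAr (state_linear hst).
Qed.

Lemma clusters_local n a n' b : clusters (inj (tree_ball n) a) (inj (tree_ball n') b).
Proof.
apply: (local_tensor_ind (fun x => clusters x (inj (tree_ball n') b))) => [|c x x'|p m hm].
- exact: clusters0l.
- exact: clustersDl.
apply: (local_tensor_ind (fun y => clusters (local_tensor p m) y)) => [|c y y'|p' m' hm'].
- exact: clusters0r.
- exact: clustersDr.
exact: clusters_local_tensor.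
Qed.

Let T1 : R := cnorm (1 : A) + 1.
Let T1_gt0 : 0 < T1. Proof. by rewrite ltr_wpDl ?cnorm_ge0. Qed.

Lemma phi_bound x s : 0 < s -> cnorm x <= s -> `|phi x| <= (8 * T1 * s)%:C.
Proof.
move=> s0 xs.
have := state_bound phi hst (iter 0 g) x 1 s T1 (iter_linear 0) (iter_mult 0) (iter_star 0) s0 T1_gt0 xs.
by rewrite /= mulr1 [8 * T1 * s]mulrAC; apply; rewrite /T1 lerDl.
Qed.

Lemma iter_bound k x y s t : 0 < s -> 0 < t -> cnorm x <= s -> cnorm y <= t ->
  `|phi (iter k g x * y)| <= (8 * s * t)%:C.
Proof. exact: state_bound (iter_linear k) (iter_mult k) (iter_star k). Qed.

Lemma phi_prod_bound x y s t : 0 < s -> 0 < t -> cnorm x <= s -> cnorm y <= t ->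
  `|phi x * phi y| <= (8 * T1 * s * (8 * T1 * t))%:C.
Proof.
move=> s0 t0 xs yt; rewrite normrM rmorphM.
by apply: ler_pM => //; exact: phi_bound.
Qed.

Let size_bound (y : A) : 0 < cnorm y + 1.
Proof. by rewrite ltr_wpDl ?cnorm_ge0. Qed.

Let le_size_bound (y : A) : cnorm y <= cnorm y + 1.
Proof. by rewrite lerDl. Qed.

Let iterB k x y : iter k g (x - y) = iter k g x - iter k g y.
Proof. by rewrite addrC -scaleN1r iter_linear scaleN1r addrC. Qed.

(** Density is used for each factor in turn: first for b local, then for all b. *)
Lemma clusters_all a b : clusters a b.
Proof.
have T0 := T1_gt0.
have step1 a' n (b' : loc R (tree_ball n)) : clusters a' (inj (tree_ball n) b').
  set y := inj _ b'; have y0 := size_bound y.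
  apply: (dense_cvg (fun k x => phi (iter k g x * y)) (fun x => phi x * phi y)
           (8 * (cnorm y + 1)) (8 * T1 * (8 * T1 * (cnorm y + 1)))).
  - by rewrite mulr_gt0.
  - by rewrite !mulr_gt0.
  - by move=> k x x'; rewrite iterB mulrBl (stateB phi hst).
  - by move=> x x'; rewrite (stateB phi hst) mulrBl.
  - by move=> k x s s0 xs; rewrite mulrAC; exact: iter_bound.
  - move=> x s s0 xs; rewrite mulrAC; exact: phi_prod_bound.
  move=> e e0; have [p [x hx]] := ball_dense a' e e0.
  by exists (inj (tree_ball p) x) => //; exact: clusters_local.
have x0 := size_bound a.
apply: (dense_cvg (fun k y => phi (iter k g a * y)) (fun y => phi a * phi y)
         (8 * (cnorm a + 1)) (8 * T1 * (cnorm a + 1) * (8 * T1))).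
- by rewrite mulr_gt0.
- by rewrite !mulr_gt0.
- by move=> k x x'; rewrite mulrBr (stateB phi hst).
- by move=> x x'; rewrite (stateB phi hst) mulrBr.
- by move=> k x s s0 xs; exact: iter_bound.
- move=> x s s0 xs; rewrite -[_ * _ * s]mulrA; exact: phi_prod_bound.
move=> e e0; have [p [x hx]] := ball_dense b e e0.
by exists (inj (tree_ball p) x); [exact: hx|exact: step1].
Qed.

Lemma phi_shift_local n a : phi (g (inj (tree_ball n) a)) = phi (inj (tree_ball n) a).
Proof.
apply: (local_tensor_ind (fun x => phi (g x) = phi x)) => [|c x y hx hy|p m hm].
- by rewrite -[g 0]/(iter 1 g 0) iter0.
- by rewrite (shift_linear hg) !(state_linear hst) hx hy.
exact: phi_shift_local_tensor.
Qed.

Lemma phi_shift a : phi (g a) = phi a.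
Proof.
have T0 := T1_gt0.
have h : (fun _ : nat => phi (g a) : R[i]^o) @ \oo --> (phi a : R[i]^o).
  apply: (dense_cvg (fun _ x => phi (g x)) phi (8 * T1) (8 * T1)).
  - by rewrite mulr_gt0.
  - by rewrite mulr_gt0.
  - by move=> _ x y; rewrite -[g (x - y)]/(iter 1 g (x - y)) iterB (stateB phi hst).
  - by move=> x y; rewrite (stateB phi hst).
  - move=> _ x s s0 xs; rewrite -[g x]/(iter 1 g x) -[iter 1 g x]mulr1 [8 * T1 * s]mulrAC.
    by apply: iter_bound => //; rewrite lerDl.
  - by move=> x s; exact: phi_bound.
  move=> e e0; have [p [x hx]] := ball_dense a e e0.
  by exists (inj (tree_ball p) x) => //; rewrite phi_shift_local; exact: cvg_cst.
have hd := @norm_hausdorff _ (R[i]^o : normedModType R[i]).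
by rewrite -(cvg_lim hd h); apply/esym/(cvg_lim hd); exact: cvg_cst.
Qed.

End Limit.

Theorem theorem7p1 (R : realType) (beta : R) (A : cstarAlgType R)
    (inj : forall L : {fset vertex}, loc R L -> A)
    (hA : is_inductive_limit inj)
    (gamma : 'I_2 -> A -> A)
    (hgamma : forall i, is_shift inj i (gamma i))
    (phi : A -> R[i])
    (hphi : is_markov_chain inj ((cosh beta ^+ 4)%:C%:M)
              (fun _ => (cosh beta ^- 4)%:C%:M) (xyK beta) phi) :
  (forall i, state_invariant phi (gamma i)) /\ (forall i, clustering phi (gamma i)).
Proof.
split=> i; first by move=> a; apply: (phi_shift inj hA beta phi hphi i _ (hgamma i)).
by move=> a b; apply: (clusters_all inj hA beta phi hphi i _ (hgamma i)).
Qed.
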